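(* Let $\Delta$ be a pure simplicial complex of dimension $m-1\ge2$ whose clique decomposition $\Delta=\Delta_1\cup\cdots\cup\Delta_r$ satisfies conditions (i) and (ii), and suppose that $G_\Delta$ is a tree. Then: (a) if $\Delta$ is closed, then $J_\Delta$ is a prime ideal; (b) $\Delta$ is closed if and only if each vertex $v_i$ of $G_\Delta$ has degree at most $\min\{|V(\Delta_i)|,\,2\dim\Delta\}$.
   Context: Let $K$ be a field, $X=(x_{ij})$ an $m\times n$ matrix of indeterminates, $S=K[X]$, and $\Delta$ a pure $(m-1)$-dimensional simplicial complex on $[n]$. For $1\le a_1<\dots<a_m\le n$, $[a_1\ldots a_m]$ is the maximal minor with columns $a_1,\dots,a_m$; $J_\Delta=(\mu_F : F\in\mathcal{F}(\Delta))$ with $\mu_F=[a_1\ldots a_m]$ for a facet $F=\{a_1<\dots<a_m\}$. Clique decomposition: let $\mathcal{S}$ be the set of simplices $\Gamma$ with vertices in $[n]$, $\dim\Gamma\ge m-1$, whose $(m-1)$-skeleton is contained in $\Delta$; the maximal elements $\Gamma_1,\dots,\Gamma_r$ of $\mathcal{S}$ give the cliques $\Delta_i=\Gamma_i^{(m-1)}$, $\Delta=\Delta_1\cup\cdots\cup\Delta_r$; $V(\Delta_i)$ is the vertex set of $\Delta_i$. Conditions: (i) $|V(\Delta_i)\cap V(\Delta_j)|\le1$ for all $i<j$; (ii) $V(\Delta_i)\cap V(\Delta_j)\cap V(\Delta_k)=\emptyset$ for all $i<j<k$. $G_\Delta$ is the simple graph on vertices $v_1,\dots,v_r$ with an edge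 $\{v_i,v_j\}$ ($i\ne j$) iff $V(\Delta_i)\cap V(\Delta_j)\ne\emptyset$. $\Delta$ is closed with respect to a labeling of its vertices by $[n]$ if for any two facets $F=\{a_1<\dots<a_m\}$, $G=\{b_1<\dots<b_m\}$ with $a_i=b_i$ for some $i$, every $m$-subset of $F\cup G$ is a facet of $\Delta$; $\Delta$ is closed if some labeling makes it closed (primality of $J_\Delta$ is independent of the labeling). *)

(* Defs.v *)
From HB Require Import structures.
From mathcomp Require Import all_boot all_order all_fingroup all_algebra.
Set Implicit Arguments. Unset Strict Implicit. Unset Printing Implicit Defensive.
Import Order.TTheory GRing.Theory.
Local Open Scope ring_scope.

Fixpoint mpoly (R : comNzRingType) (k : nat) : comNzRingType :=
  if k is k'.+1 then ({poly mpoly R k'} : comNzRingType) else R.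

(* The variable y_i in mpoly R k (0 if i >= k, never used that way). *)
Fixpoint mvar (R : comNzRingType) (k i : nat) : mpoly R k :=
  match k return mpoly R k with
  | 0 => 0
  | k'.+1 => if i == k' then ('X : {poly mpoly R k'}) else (mvar R k' i)%:P
  end.

Definition Sring (K : fieldType) (m n : nat) : comNzRingType := mpoly K (m * n).
Definition xvar (K : fieldType) (m n i j : nat) : Sring K m n := mvar K (m * n) (i * n + j).

(* Vertices of Delta are labelled by 'I_n (i.e. [n] shifted to {0..n-1}).
   A pure complex is given by its set of facets. *)
Definition sorted_vertices n (F : {set 'I_n}) : seq nat :=
  sort leq [seq val x | x <- enum F].

Definition minor (K : fieldType) (m n : nat) (F : {set 'I_n}) : Sring K m n :=
  \det (\matrix_(i < m, j < m) xvar K m n i (nth 0%N (sorted_vertices F) j)).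

Definition J_Delta (K : fieldType) (m n : nat) (Fs : {set {set 'I_n}}) : Sring K m n -> Prop :=
  fun p => exists c : {set 'I_n} -> Sring K m n,
                 p = \sum_(F in Fs) c F * minor K m F.

Definition prime_ideal (R : comNzRingType) (I : R -> Prop) : Prop :=
  (forall a b, I a -> I b -> I (a + b)) /\ (forall a b, I b -> I (a * b)) /\ I 0 /\
  ~ I 1 /\ (forall a b, I (a * b) -> I a \/ I b).

Definition pure_dim (m n : nat) (Fs : {set {set 'I_n}}) : Prop :=
  Fs != set0 /\ forall F, F \in Fs -> #|F| = m.

(* the set S: simplices Gamma with dim >= m-1 whose (m-1)-skeleton lies in Delta *)
Definition in_S (m n : nat) (Fs : {set {set 'I_n}}) (G : {set 'I_n}) : bool :=
  (m <= #|G|)%N && [forall F : {set 'I_n}, ((F \subset G) && (#|F| == m)) ==> (F \in Fs)].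

(* vertex sets V(Delta_i) of the cliques = maximal elements of S *)
Definition cliques (m n : nat) (Fs : {set {set 'I_n}}) : {set {set 'I_n}} :=
  [set G | maxset (in_S m Fs) G].

Definition cond_i (m n : nat) (Fs : {set {set 'I_n}}) : Prop :=
  forall C D, C \in cliques m Fs -> D \in cliques m Fs -> C != D -> (#|C :&: D| <= 1)%N.

Definition cond_ii (m n : nat) (Fs : {set {set 'I_n}}) : Prop :=
  forall C D E, C \in cliques m Fs -> D \in cliques m Fs -> E \in cliques m Fs ->
    C != D -> C != E -> D != E -> C :&: D :&: E = set0.

Definition gadj (m n : nat) (Fs : {set {set 'I_n}}) : rel {set 'I_n} :=
  fun C D => [&& C \in cliques m Fs, D \in cliques m Fs, C != D & C :&: D != set0].

Definition connected_graph (T : eqType) (V : pred T) (e : rel T) : Prop :=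
  forall u v, V u -> V v -> exists p : seq T, path e u p /\ last u p = v.

Definition acyclic_graph (T : eqType) (e : rel T) : Prop :=
  forall c : seq T, (3 <= size c)%N -> uniq c -> ~~ path.cycle e c.

Definition is_tree (T : eqType) (V : pred T) (e : rel T) : Prop :=
  connected_graph V e /\ acyclic_graph e.

Definition G_Delta_tree (m n : nat) (Fs : {set {set 'I_n}}) : Prop :=
  is_tree (fun C => C \in cliques m Fs) (gadj m Fs).

Definition deg_G (m n : nat) (Fs : {set {set 'I_n}}) (C : {set 'I_n}) : nat :=
  #|[set D | gadj m Fs C D]|.

Definition closed_wrt (m n : nat) (Fs : {set {set 'I_n}}) : Prop :=
  forall F G, F \in Fs -> G \in Fs ->
    (exists2 i, (i < m)%N & nth 0%N (sorted_vertices F) i = nth 0%N (sorted_vertices G) i) ->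
    forall H : {set 'I_n}, H \subset F :|: G -> #|H| = m -> H \in Fs.

Definition is_closed (m n : nat) (Fs : {set {set 'I_n}}) : Prop :=
  exists s : {perm 'I_n}, closed_wrt m [set (s @: F) | F : {set 'I_n} in Fs].

(* Main.v *)
(* Order the columns by a closed labelling.  For a single clique, the leading monomial of any
   polynomial vanishing on the matrices of rank < m (over an infinite field) is divisible by a
   diagonal monomial x_(1,a_1) ... x_(m,a_m): this is an induction on the variables, each step of
   which lets one entry of a degenerate matrix tend to infinity along a curve or deforms the matrix
   along a line.  So the maximal minors of a clique are a Groebner basis.  Closedness says that a
   vertex common to two cliques never occupies the same position in a facet of each, so the leading
   monomials of different cliques are coprime, hence the minors of all cliques together form a
   Groebner basis of J_Delta.

   Primality follows by attaching the cliques of the tree one at a time.  If C meets the previous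
   cliques only in u, there is a closed labelling in which u is the last vertex of C and the first
   one of the other clique through u.  The leading monomial of the minor gamma on the first m-1 rows
   and the last m-1 columns of C is then coprime to all diagonal monomials (this uses m >= 3), so
   gamma is regular modulo J_Delta.  Away from gamma = 0 the last entries of the other columns of C
   are determined by the remaining ones, which turns a generic point of the smaller ideal into a
   generic point of J_Delta: an ideal with a generic point over a field is prime.

   A labelling is closed iff, for every vertex v common to cliques C and D, the number of vertices
   of C below v plus the number of vertices of D above v is less than m-1, or the same with C and D
   exchanged.  This forces v to be among the first or last m-1 vertices of C, whence the degree
   bound; conversely a labelling is built along the tree, each new clique being placed entirely
   before or entirely after its attaching vertex. *)
Require Import Defs.
From HB Require Import structures.
From mathcomp Require Import all_boot all_order all_fingroup all_algebra.
From mathcomp Require Import zify ring.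
Import GRing.Theory.
Set Implicit Arguments. Unset Strict Implicit. Unset Printing Implicit Defensive.
Local Open Scope ring_scope.

(** * Evaluation and leading monomials of iterated polynomials *)

Fixpoint mconst (R : comNzRingType) (k : nat) : {rmorphism R -> mpoly R k} :=
  match k return {rmorphism R -> mpoly R k} with
  | 0 => [the {rmorphism R -> R} of idfun]
  | k'.+1 => [the {rmorphism R -> {poly mpoly R k'}} of (polyC \o mconst R k')]
  end.

(** A point is a function on all of [nat], so that the same point can be evaluated in any number of
    variables; only its first [k] values count. *)
Fixpoint mev (R L : comNzRingType) (iota : {rmorphism R -> L}) (p : nat -> L) (k : nat) :
    {rmorphism mpoly R k -> L} :=
  match k return {rmorphism mpoly R k -> L} with
  | 0 => iota
  | k'.+1 => [the {rmorphism {poly mpoly R k'} -> L} of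
               (horner_eval (p k') \o map_poly (mev iota p k'))]
  end.

Lemma mevS (R L : comNzRingType) (iota : {rmorphism R -> L}) p k (f : {poly mpoly R k}) :
  mev iota p k.+1 f = (map_poly (mev iota p k) f).[p k].
Proof. by []. Qed.

Lemma mev_const (R L : comNzRingType) (iota : {rmorphism R -> L}) p k c :
  mev iota p k (mconst R k c) = iota c.
Proof. by elim: k => [|k IH] //; rewrite mevS /= map_polyC hornerC. Qed.

Lemma mev_var (R L : comNzRingType) (iota : {rmorphism R -> L}) p k i :
  (i < k)%N -> mev iota p k (mvar R k i) = p i.
Proof.
elim: k => [//|k IH] lik; rewrite mevS /=.
case: eqVneq => [->|nik]; first by rewrite map_polyX hornerX.
by rewrite map_polyC hornerC /= IH // ltn_neqAle nik -ltnS.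
Qed.

(** This induction hides the nesting of univariate polynomials: identities between morphisms are
    checked on constants and variables only. *)
Lemma mpoly_ind (R : comNzRingType) k (P : mpoly R k -> Prop) :
  (forall c, P (mconst R k c)) -> (forall i, (i < k)%N -> P (mvar R k i)) ->
  (forall f g, P f -> P g -> P (f + g)) -> (forall f g, P f -> P g -> P (f * g)) ->
  forall f, P f.
Proof.
elim: k P => [P Pc _ _ _ f|k IH P Pc Pv PD PM]; first exact: Pc.
have PX : P 'X by have := Pv k (ltnSn k); rewrite /= eqxx.
have PC (c : mpoly R k) : P c%:P.
  apply: (IH (fun c => P c%:P)) => [a|i lik|f g Pf Pg|f g Pf Pg].
  - exact: Pc.
  - by have := Pv i (ltnW lik); rewrite /= (ltn_eqF lik).
  - by rewrite polyCD; apply: PD.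
  - by rewrite polyCM; apply: PM.
by elim/poly_ind => [|f c Pf]; [exact: PC 0 | apply: PD => //; apply: PM].
Qed.

Lemma mev_comp (R L L' : comNzRingType) (iota : {rmorphism R -> L})
    (iota' : {rmorphism R -> L'}) (g : {rmorphism L -> L'}) p p' k f :
  (forall c, g (iota c) = iota' c) -> (forall i, (i < k)%N -> g (p i) = p' i) ->
  g (mev iota p k f) = mev iota' p' k f.
Proof.
move=> gi gp; elim/mpoly_ind: f => [c|i lik|f h IHf IHh|f h IHf IHh].
- by rewrite !mev_const.
- by rewrite !mev_var // gp.
- by rewrite !rmorphD IHf IHh.
- by rewrite !rmorphM IHf IHh.
Qed.

Lemma eq_mev (R L : comNzRingType) (iota : {rmorphism R -> L}) p p' k f :
  (forall i, (i < k)%N -> p i = p' i) -> mev iota p k f = mev iota p' k f.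
Proof. by move=> pp'; apply: (@mev_comp _ _ _ _ _ [the {rmorphism L -> L} of idfun]). Qed.

Section Lead.
Variable K : fieldType.
Implicit Types k : nat.

(* The exponent of variable [i] in the leading monomial, for the lexicographic order in which the
   last variable is the largest, the order that iterated leading coefficients see; junk value 0 at
   the zero polynomial. *)
Fixpoint lme k : mpoly K k -> nat -> nat :=
  match k return mpoly K k -> nat -> nat with
  | 0 => fun _ _ => 0%N
  | k'.+1 => fun (f : {poly mpoly K k'}) i =>
     if i == k' then (size f).-1 else lme (lead_coef f) i
  end.

(* Strict comparison of leading monomials, with the zero polynomial below all others. *)
Fixpoint llt k : mpoly K k -> mpoly K k -> Prop :=
  match k return mpoly K k -> mpoly K k -> Prop with
  | 0 => fun f g => f = 0 /\ g != 0
  | k'.+1 => fun (f g : {poly mpoly K k'}) =>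
     (size f < size g)%N \/ (size f = size g /\ llt (lead_coef f) (lead_coef g))
  end.


Lemma mpoly_eq0 k (f : mpoly K k.+1) :
  (f == 0) = (lead_coef (f : {poly mpoly K k}) == 0).
Proof. by symmetry; exact: lead_coef_eq0. Qed.

Lemma mpoly_mulf_neq0 k (f g : mpoly K k) : f != 0 -> g != 0 -> f * g != 0.
Proof.
elim: k f g => [|k IH] f g; first exact: mulf_neq0.
rewrite !mpoly_eq0 => f0 g0; rewrite [lead_coef _](lead_coef_proper_mul (IH _ _ f0 g0)).
exact: IH.
Qed.

Lemma size_mpolyM k (f g : {poly mpoly K k}) : f != 0 -> g != 0 ->
  (size (f * g)%R).-1 = ((size f).-1 + (size g).-1)%N.
Proof.
move=> f0 g0; rewrite size_proper_mul; last first.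
  by apply: mpoly_mulf_neq0; rewrite lead_coef_eq0.
by rewrite (polySpred f0) (polySpred g0) addSn addnS.
Qed.

Lemma lead_mpolyM k (f g : {poly mpoly K k}) : f != 0 -> g != 0 ->
  lead_coef (f * g) = lead_coef f * lead_coef g.
Proof.
by move=> f0 g0; apply/lead_coef_proper_mul/mpoly_mulf_neq0; rewrite lead_coef_eq0.
Qed.

Lemma lmeM k (f g : mpoly K k) i : f != 0 -> g != 0 ->
  lme (f * g) i = (lme f i + lme g i)%N.
Proof.
elim: k f g => [|k IH] f g // f0 g0 /=.
case: eqP => _; first exact: (@size_mpolyM k f g).
rewrite [lead_coef _](@lead_mpolyM k f g) //.
by rewrite IH // -mpoly_eq0.
Qed.

Lemma lltP k (f g : mpoly K k) : llt f g -> g != 0.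
Proof.
elim: k f g => [|k IH] f g /=; first by case.
case=> [|[_ /IH]]; last by rewrite -mpoly_eq0.
by move=> fg; rewrite -[g != 0](@size_poly_gt0 (mpoly K k)); apply: leq_ltn_trans fg.
Qed.

Lemma llt0 k (g : mpoly K k) : g != 0 -> llt 0 g.
Proof.
elim: k g => [|k IH] g //= g0; left.
by rewrite size_poly0 size_poly_gt0.
Qed.

(** Lexicographic: strong induction on the size in the last variable, then well-founded induction on
    the leading coefficient. It provides the termination of every division argument below. *)
Lemma llt_wf k : well_founded (@llt k).
Proof.
elim: k => [|k IH] f.
  by constructor=> g [-> _]; constructor=> h [_]; rewrite eqxx.
have [n] := ubnP (size (f : {poly mpoly K k})).
elim: n f => [//|n IHn] f; rewrite ltnS => sf.
have [l El] : exists l, l = lead_coef (f : {poly mpoly K k}) by eexists.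
elim/(well_founded_induction IH): l f sf El => l IHl f sf El.
constructor=> g /= [gf|[gf lgf]].
  by apply: IHn; apply: leq_trans gf sf.
by apply: (IHl (lead_coef (g : {poly mpoly K k}))); rewrite ?El ?gf.
Qed.

Lemma llt_total k (f g : mpoly K k) : f != 0 -> g != 0 ->
  [\/ llt f g, llt g f | forall i, lme f i = lme g i].
Proof.
elim: k f g => [|k IH] f g f0 g0 /=; first by constructor 3.
have [fg|gf|fg] := ltngtP (size (f : {poly mpoly K k})) (size (g : {poly mpoly K k})).
- by constructor 1; left.
- by constructor 2; left.
have [||fg'|gf'|E] := IH (lead_coef (f : {poly mpoly K k})) (lead_coef (g : {poly mpoly K k})).
- by rewrite -mpoly_eq0.
- by rewrite -mpoly_eq0.
- by constructor 1; right.
- by constructor 2; right.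
by constructor 3 => i; rewrite fg E.
Qed.

Lemma lme_out k (f : mpoly K k) i : (k <= i)%N -> lme f i = 0%N.
Proof.
elim: k f => [|k IH] f //= ki; rewrite gtn_eqF // IH //; exact: ltnW.
Qed.

Lemma lme_lead k (f g : mpoly K k.+1) : (forall i, lme f i = lme g i) ->
  forall i, lme (lead_coef (f : {poly mpoly K k})) i =
            lme (lead_coef (g : {poly mpoly K k})) i.
Proof.
move=> E i; have := E i; rewrite /=; case: eqP => // -> _.
by rewrite !lme_out.
Qed.

Lemma lme_size k (f g : mpoly K k.+1) : f != 0 -> g != 0 ->
  (forall i, lme f i = lme g i) ->
  size (f : {poly mpoly K k}) = size (g : {poly mpoly K k}).
Proof.
move=> f0 g0 /(_ k) /=; rewrite eqxx => E.
by rewrite (polySpred f0) (polySpred g0) E.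
Qed.

Lemma llt_lme k (a f g : mpoly K k) : f != 0 -> g != 0 ->
  (forall i, lme f i = lme g i) -> llt a f -> llt a g.
Proof.
elim: k a f g => [|k IH] a f g f0 g0 E /=; first by case.
rewrite (lme_size f0 g0 E) => -[?|[? H]]; [by left | right; split=> //].
by apply: IH (lme_lead E) H; rewrite -mpoly_eq0.
Qed.

Lemma lme_llt k (f g : mpoly K k) i : f != 0 -> g != 0 -> (lme f i < lme g i)%N ->
  (forall j, (i < j)%N -> lme f j = lme g j) -> llt f g.
Proof.
elim: k f g => [|k IH] f g f0 g0 //= lti E.
case: (ltngtP i k) => [ik|ki|ik].
- right; split.
    by have := E k ik; rewrite eqxx => E'; rewrite (polySpred f0) (polySpred g0) E'.
  apply: IH; rewrite -?mpoly_eq0 //; first by move: lti; rewrite ltn_eqF.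
  move=> j ij; have := E j ij; case: eqP => // -> _.
  by rewrite !lme_out.
- by move: lti; rewrite gtn_eqF // !lme_out // ltnW.
- by left; move: lti; rewrite ik eqxx (polySpred f0) (polySpred g0).
Qed.

Lemma lltDr k (a f : mpoly K k) : llt a f ->
  f + a != 0 /\ forall i, lme (f + a) i = lme f i.
Proof.
move=> af; have f0 := lltP af.
elim: k a f f0 af => [|k IH] a f f0 /=; first by move=> [-> _]; rewrite addr0.
case=> [lt|[E lt]].
  have sz := @size_polyDl (mpoly K k) _ _ lt.
  have ld := @lead_coefDl (mpoly K k) _ _ lt.
  split; last by move=> i; rewrite sz ld.
  by rewrite -[_ != 0](@size_poly_gt0 (mpoly K k)) sz size_poly_gt0.
have lf0 := lltP lt; have [ne eqm] := IH _ _ lf0 lt.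
(* At equal sizes the leading coefficients add, and by induction the sum is nonzero, so the size
   does not drop. *)
have cE : ((f : {poly mpoly K k}) + a)%R`_(size (f : {poly mpoly K k})).-1 =
          lead_coef (f : {poly mpoly K k}) + lead_coef (a : {poly mpoly K k}).
  by rewrite coefD !lead_coefE E.
have sz : size ((f : {poly mpoly K k}) + a)%R = size (f : {poly mpoly K k}).
  apply/eqP; rewrite eqn_leq; apply/andP; split.
    by rewrite (leq_trans (size_polyD _ _)) // E maxnn.
  rewrite (polySpred f0) ltnNge; apply/negP => h.
  by move: ne; rewrite -cE nth_default ?eqxx.
have ld : lead_coef ((f : {poly mpoly K k}) + a)%R =
          lead_coef (f : {poly mpoly K k}) + lead_coef (a : {poly mpoly K k}).
  by rewrite lead_coefE sz cE.
split; last by move=> i; rewrite [size _]sz [lead_coef _]ld eqm.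
by rewrite mpoly_eq0 [lead_coef _]ld.
Qed.

Lemma llt_add k (a b f : mpoly K k) : llt a f -> llt b f -> llt (a + b) f.
Proof.
elim: k a b f => [|k IH] a b f /=; first by move=> [-> ?] [-> _]; rewrite addr0.
move=> af bf.
have sab : (size ((a : {poly mpoly K k}) + b)%R <= size (f : {poly mpoly K k}))%N.
  apply: leq_trans (size_polyD _ _) _; rewrite geq_max.
  by case: af => [/ltnW ->|[-> _]]; case: bf => [/ltnW ->|[-> _]]; rewrite ?leqnn.
move: sab; rewrite leq_eqVlt => /orP[/eqP sab|]; [right; split=> //|by left].
rewrite lead_coefE sab coefD; set n := (size _).-1.
have f0 : lead_coef (f : {poly mpoly K k}) != 0.
  have : (0 < size (f : {poly mpoly K k}))%N.
    by case: af => [|[_ /lltP]]; [exact: leq_ltn_trans | rewrite lead_coef_eq0 size_poly_gt0].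
  by rewrite lead_coef_eq0 size_poly_gt0.
(* A summand of smaller size contributes the default coefficient 0, which lies below the nonzero
   leading coefficient of [f]. *)
have aux (c : {poly mpoly K k}) : (size c < size (f : {poly mpoly K k}))%N \/
   size c = size (f : {poly mpoly K k}) /\
   llt (lead_coef c) (lead_coef (f : {poly mpoly K k})) ->
   llt c`_n (lead_coef (f : {poly mpoly K k})).
  case=> [lt|[E]]; last by rewrite [lead_coef c]lead_coefE E.
  rewrite nth_default; first exact: llt0.
  by rewrite /n -ltnS prednK // (leq_ltn_trans _ lt).
by apply: IH; apply: aux.
Qed.

Lemma mconst_neq0 k (c : K) : c != 0 -> mconst K k c != 0.
Proof.
elim: k => [|k IH] // c0; have := IH c0.
by rewrite mpoly_eq0 [lead_coef _]lead_coefC.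
Qed.

Lemma lme_const k (c : K) i : lme (mconst K k c) i = 0%N.
Proof.
elim: k => [|k IH] //=; rewrite lead_coefC IH size_polyC.
by case: eqP => // _; case: eqP.
Qed.

(** The scalar [c] is the quotient of the two innermost leading coefficients, which lie in the field
    [K]. *)
Lemma llt_subr k (f g : mpoly K k) : f != 0 -> g != 0 ->
  (forall i, lme f i = lme g i) -> exists2 c : K, c != 0 & llt (f - mconst K k c * g) f.
Proof.
elim: k f g => [|k IH] f g f0 g0 E.
  exists (f / g); first by rewrite mulf_neq0 ?invr_neq0.
  by split=> //=; rewrite divfK // subrr.
have [||c c0 H] := IH _ _ _ _ (lme_lead E); rewrite -?mpoly_eq0 //.
exists c => //.
have sz := lme_size f0 g0 E.
have cg0 : (mconst K k c)%:P * (g : {poly mpoly K k}) != 0.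
  by apply: (@mpoly_mulf_neq0 k.+1); rewrite // (mconst_neq0 k.+1).
have scg : size ((mconst K k c)%:P * (g : {poly mpoly K k}))%R = size (g : {poly mpoly K k}).
  by have := lme_size cg0 g0; apply=> i;
    rewrite (@lmeM k.+1 (mconst K k.+1 c)) ?lme_const // (mconst_neq0 k.+1).
change (let d := (f : {poly mpoly K k}) - (mconst K k c)%:P * (g : {poly mpoly K k}) in
  (size d < size (f : {poly mpoly K k}))%N \/ (size d = size (f : {poly mpoly K k}) /\
  llt (lead_coef d) (lead_coef (f : {poly mpoly K k})))).
move=> d.
have sd : (size d <= size (f : {poly mpoly K k}))%N.
  by apply: leq_trans (size_polyD _ _) _; rewrite size_polyN scg sz maxnn.
move: sd; rewrite leq_eqVlt => /orP[/eqP sd|]; [right; split=> //|by left].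
by rewrite [lead_coef d]lead_coefE sd coefB coefCM {2}sz.
Qed.
End Lead.

(** * Groebner bases *)

Definition ideal (R : comNzRingType) (I : R -> Prop) : Prop :=
  [/\ I 0, forall a b, I a -> I b -> I (a + b) & forall a b, I b -> I (a * b)].

Definition ideal_sum (R : comNzRingType) (I J : R -> Prop) (f : R) : Prop :=
  exists a b, [/\ I a, J b & f = a + b].

Lemma idealB (R : comNzRingType) (I : R -> Prop) a b :
  ideal I -> I a -> I b -> I (a - b).
Proof. by case=> _ ID IM Ia Ib; rewrite -mulN1r; apply: ID => //; apply: IM. Qed.

Lemma ideal_sumP (R : comNzRingType) (I J : R -> Prop) :
  ideal I -> ideal J -> ideal (ideal_sum I J).
Proof.
move=> [I0 ID IM] [J0 JD JM]; split.
- by exists 0, 0; rewrite addr0.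
- move=> _ _ [a [b [Ia Jb ->]]] [c [d [Ic Jd ->]]].
  by exists (a + c), (b + d); split; [exact: ID | exact: JD | exact: addrACA].
- move=> r _ [a [b [Ia Jb ->]]]; exists (r * a), (r * b).
  by rewrite mulrDr; split; [exact: IM | exact: JM |].
Qed.

Section Groebner.
Variables (K : fieldType) (k : nat).
Implicit Types (f g h : mpoly K k) (I J D E : mpoly K k -> Prop).

Lemma lme1 i : lme (1 : mpoly K k) i = 0%N.
Proof. by rewrite -(rmorph1 (mconst K k)) lme_const. Qed.

Lemma mvar_neq0 i : (i < k)%N -> mvar K k i != 0.
Proof.
move=> ik; apply/eqP => E.
have := mev_var [the {rmorphism K -> K} of idfun] (fun=> 1) ik.
by move/eqP; rewrite E rmorph0 eq_sym oner_eq0.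
Qed.

Lemma lmeV i j : (i < k)%N -> lme (mvar K k i) j = (j == i).
Proof.
elim: k i => [//|l IH] i il /=; case: (eqVneq i l) => [->|nil].
  by rewrite size_polyX lead_coefX -(rmorph1 (mconst K l)) lme_const; case: eqP.
have {}il : (i < l)%N by rewrite ltn_neqAle nil -ltnS.
rewrite lead_coefC IH // size_polyC.
by case: (eqVneq j l) => // ->; rewrite gtn_eqF //; case: eqP.
Qed.

Lemma monomial_exists (e : nat -> nat) :
  exists2 h : mpoly K k, h != 0 & forall i, (i < k)%N -> lme h i = e i.
Proof.
elim: k => [|l [h h0 E]]; first by exists 1; rewrite ?oner_neq0.
exists (h%:P * 'X^(e l) : {poly mpoly K l}); last first.
  move=> i il /=; have -> : (size (h%:P * 'X^(e l))%R).-1 = e l.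
    by rewrite size_Mmonic ?monicXn ?polyC_eq0 // size_polyXn size_polyC h0.
  by rewrite lead_coef_Mmonic ?monicXn // lead_coefC; case: eqP => [->//|?]; apply: E; lia.
by rewrite mpoly_eq0 [lead_coef _]lead_coef_Mmonic ?monicXn // lead_coefC.
Qed.

Definition lme_div g f := forall i, (lme g i <= lme f i)%N.

(** One step of division: [h] is the quotient of the leading monomials, scaled so that the leading
    terms cancel. *)
Lemma lead_reduce f g : f != 0 -> g != 0 -> lme_div g f ->
  exists2 h, h != 0 & llt (f - h * g) f.
Proof.
move=> f0 g0 gf; have [h h0 E] := monomial_exists (fun i => lme f i - lme g i)%N.
have [|i|c c0] := @llt_subr K k f (h * g) f0; first exact: mpoly_mulf_neq0.
  rewrite lmeM //; have [ik|ki] := ltnP i k; last by rewrite !lme_out.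
  by rewrite E // subnK.
by rewrite mulrA => H; exists (mconst K k c * h); rewrite ?mpoly_mulf_neq0 ?mconst_neq0.
Qed.

Definition groebner I D : Prop :=
  [/\ ideal I, forall g, D g -> I g /\ g != 0 &
      forall f, I f -> f != 0 -> exists2 g, D g & lme_div g f].

Definition lme_coprime g h := forall i, lme g i = 0%N \/ lme h i = 0%N.

(** The coprime case of Buchberger's criterion. A decomposition [a + b] is improved by well-founded
    induction on [a] until the leading terms of [a] and [b] no longer cancel. *)
Lemma groebner_sum I J D E : groebner I D -> groebner J E ->
  (forall g h, D g -> E h -> lme_coprime g h) ->
  groebner (ideal_sum I J) (fun g => D g \/ E g).
Proof.
move=> [iI DI GI] [iJ EJ GJ] cop; split; first exact: ideal_sumP.
  move=> g [/DI[Ig g0]|/EJ[Jg g0]]; split=> //.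
    by exists g, 0; rewrite addr0; split=> //; case: iJ.
  by exists 0, g; rewrite add0r; split=> //; case: iI.
have GIl f a : I a -> a != 0 -> (forall i, lme f i = lme a i) ->
    exists2 g, D g \/ E g & lme_div g f.
  by move=> Ia a0 eqm; have [g Dg ga] := GI _ Ia a0; exists g; [left | move=> i; rewrite eqm].
move=> _ [a [b [Ia Jb ->]]].
elim/(well_founded_induction (@llt_wf K k)): a b Ia Jb => a IHa b Ia Jb.
have [->|a0] := eqVneq a 0.
  by rewrite add0r => b0; have [g Eg gb] := GJ _ Jb b0; exists g => //; right.
have [->|b0] := eqVneq b 0; first by rewrite addr0 => _; exact: GIl Ia _ _.
have [ab|ba|eqm] := llt_total a0 b0.
- have [_ eqm] := lltDr ab; rewrite addrC => _.
  have [g Eg gb] := GJ _ Jb b0; exists g; first by right.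
  by move=> i; rewrite eqm.
- by have [_ eqm] := lltDr ba => _; exact: GIl Ia _ _.
have [c c0 lt] := llt_subr b0 a0 (fun i => esym (eqm i)).
(* Leading terms cancel only if [c = -1]; then the common leading monomial is divisible by some
   [g * h] with [g] in [D] and [h] in [E], a multiple of which is moved from [a] to [b]. *)
have [cN1|cN1] := eqVneq (1 + c) 0; last first.
  have ne : mconst K k (1 + c) * a != 0 by rewrite mpoly_mulf_neq0 ?mconst_neq0.
  have eqm' i : lme (mconst K k (1 + c) * a) i = lme a i.
    by rewrite lmeM ?mconst_neq0 // lme_const.
  have [|_ H] := @lltDr K k (b - mconst K k c * a) (mconst K k (1 + c) * a).
    by apply: llt_lme lt => // i; rewrite eqm' eqm.
  have -> : a + b = mconst K k (1 + c) * a + (b - mconst K k c * a).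
    by rewrite rmorphD rmorph1; ring.
  by move=> _; apply: GIl Ia a0 _ => i; rewrite H eqm'.
have [g Dg ga] := GI _ Ia a0; have [h Eh hb] := GJ _ Jb b0.
have [Ig g0] := DI _ Dg; have [Jh h0] := EJ _ Eh.
have gh0 : g * h != 0 by exact: mpoly_mulf_neq0.
have gha : lme_div (g * h) a.
  move=> i; rewrite lmeM //; case: (cop g h Dg Eh i) => ->; rewrite ?add0n ?addn0 //.
  by rewrite eqm.
have [r _ ltr] := lead_reduce a0 gh0 gha.
have -> : a + b = (a - r * (g * h)) + (b + r * (g * h)) by ring.
apply: IHa => //.
  have -> : r * (g * h) = r * h * g by ring.
  by apply: idealB => //; case: iI => _ _; apply.
have -> : r * (g * h) = r * g * h by ring.
by case: (iJ) => _ JD JM; apply: JD => //; apply: JM.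
Qed.

(** A leading monomial of [D] that divides the one of [g * f] is coprime to [g], hence divides the
    one of [f]. So [f] can be reduced modulo [I], and the induction goes on with the remainder. *)
Lemma groebner_regular I D g : groebner I D -> g != 0 ->
  (forall h, D h -> lme_coprime g h) -> forall f, I (g * f) -> I f.
Proof.
move=> [iI DI GI] g0 cop f.
elim/(well_founded_induction (@llt_wf K k)): f => f IH If.
have [->|f0] := eqVneq f 0; first by case: iI.
have [h Dh hgf] := GI _ If (mpoly_mulf_neq0 g0 f0).
have [Ih h0] := DI _ Dh.
have hf : lme_div h f.
  move=> i; have := hgf i; rewrite lmeM //.
  by case: (cop h Dh i) => ->.
have [r _ lt] := lead_reduce f0 h0 hf.
have Irh : I (r * h) by case: iI => _ _; apply.
rewrite -(subrK (r * h) f); case: (iI) => _ ID IM; apply: ID => //.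
by apply: IH => //; rewrite mulrBr; apply: idealB => //; apply: IM.
Qed.
End Groebner.

(** Rows and columns are selected by functions, so that deleting a row and a column gives a matrix
    of the same form. *)
Definition varmx (K : fieldType) (k n s t : nat) (r : 'I_s -> nat) (a : 'I_t -> nat) :=
  \matrix_(i < s, j < t) mvar K k (r i * n + a j).

(** The leading monomial is the diagonal one. In the expansion along the last row, only the term of
    the last column contains the largest variable, and its cofactor is handled by induction. *)
Lemma lme_det_varmx (K : fieldType) k n t (r a : 'I_t -> nat) :
  (forall i j : 'I_t, (i < j)%N -> (r i < r j)%N) ->
  (forall i j : 'I_t, (i < j)%N -> (a i < a j)%N) ->
  (forall j, (a j < n)%N) -> (forall i j, (r i * n + a j < k)%N) ->
  \det (varmx K k n r a) != 0 /\
  forall x, lme (\det (varmx K k n r a)) x = (\sum_(i < t) (x == r i * n + a i))%N.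
Proof.
elim: t r a => [|t IH] r a rlt alt an ak.
  by rewrite det_mx00 oner_neq0; split=> // x; rewrite big_ord0 lme1.
have minorE j : row' ord_max (col' j (varmx K k n r a)) =
    varmx K k n (r \o lift ord_max) (a \o lift j).
  by apply/matrixP => i l; rewrite !mxE.
have lltlift (h : 'I_t.+1) (i j : 'I_t) : (i < j)%N -> (lift h i < lift h j)%N.
  by rewrite /= /bump; do 2 case: leqP => ?; lia.
pose F j := varmx K k n r a ord_max j * cofactor (varmx K k n r a) ord_max j.
have FE j : F j != 0 /\ forall x, lme (F j) x =
   ((x == r ord_max * n + a j) +
    \sum_(i < t) (x == r (lift ord_max i) * n + a (lift j i)))%N.
  have [||||d0 dE] := IH (r \o lift ord_max) (a \o lift j); rewrite /=; try by move=> *; auto.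
  have sE : (-1) ^+ (t + j)%N = mconst K k ((-1) ^+ (t + j)%N) :> mpoly K k.
    by rewrite rmorph_sign.
  have s0 : mconst K k ((-1) ^+ (t + j)%N) != 0.
    by rewrite mconst_neq0 // signr_eq0.
  rewrite /F /cofactor minorE sE mxE; split.
    by rewrite !mpoly_mulf_neq0 ?mvar_neq0.
  by move=> x; rewrite !lmeM ?mpoly_mulf_neq0 ?mvar_neq0 // lmeV // lme_const dE.
have detE : \det (varmx K k n r a) =
    F ord_max + \sum_(j < t) F (widen_ord (leqnSn t) j).
  by rewrite (expand_det_row _ ord_max) big_ord_recr addrC.
have liftE (i : 'I_t) : lift ord_max i = widen_ord (leqnSn t) i.
  by apply: val_inj; rewrite /= /bump leqNgt ltn_ord.
have F0 := (FE ord_max).1.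
have lt : llt (\sum_(j < t) F (widen_ord (leqnSn t) j)) (F ord_max).
  elim/big_ind: _ => [|x y|j _]; [exact: llt0 | move=> Hx Hy; exact: llt_add Hx Hy |].
  set j' := widen_ord _ j; have jt : (a j' < a ord_max)%N by apply: alt; rewrite /= ltn_ord.
  (* Columns are below [n], so variables of earlier rows have indices smaller than
     [r ord_max * n]. *)
  have small x (h : 'I_t.+1) : (r ord_max * n <= x)%N ->
      (\sum_(i < t) (x == r (lift ord_max i) * n + a (lift h i)) = 0)%N.
    move=> rx; apply: big1 => i _; apply/eqP; rewrite eqb0 gtn_eqF //.
    apply: leq_trans rx; have := rlt (lift ord_max i) ord_max.
    rewrite lift_max ltn_ord => /(_ isT) ri; have := an (lift h i) => ai.
    by nia.
  apply: (@lme_llt K k _ _ (r ord_max * n + a ord_max)) => //; first exact: (FE j').1.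
    by rewrite !(FE _).2 !small ?leq_addr // eqxx eqn_add2l gtn_eqF.
  by move=> x lx; rewrite !(FE _).2 !small ?gtn_eqF //; lia.
have [d0 dE] := lltDr lt; rewrite detE; split=> // x; rewrite dE (FE _).2 big_ord_recr addnC /=.
by congr (_ + _)%N; apply: eq_bigr => i _; rewrite liftE.
Qed.

(** * Leading monomials on the degenerate locus *)

(* Points are functions of the variable index: entry (i, w) is [p (i * n + w)]. *)
Definition degenerate (L : fieldType) n (s : nat) (V : {set 'I_n}) (p : nat -> L) : Prop :=
  exists phi : nat -> L, (exists2 i, (i < s)%N & phi i != 0) /\
    forall w, w \in V -> \sum_(i < s) phi i * p (i * n + w)%N = 0.

(** Read [e] as an exponent vector: its monomial is divisible by the diagonal monomial of some [s]
    columns from [V]. *)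
Definition has_diag n (s : nat) (V : {set 'I_n}) (e : nat -> nat) : Prop :=
  exists a : 'I_s -> 'I_n, [/\ forall i j : 'I_s, (i < j)%N -> (a i < a j)%N,
    forall i, a i \in V & forall i : 'I_s, (0 < e (i * n + a i))%N].

Section DegenerateLocus.
Variables (K L : fieldType) (iota : {rmorphism K -> L}) (n : nat).
(** Infinitude of [L], in the form suited to lines and curves whose parameter must avoid 0. *)
Hypothesis infL : forall q : {poly L}, (forall t, t != 0 -> q.[t] = 0) -> q = 0.

Definition mline (p q : nat -> L) k : {rmorphism mpoly K k -> {poly L}} :=
  mev [the {rmorphism K -> {poly L}} of (polyC \o iota)] (fun i => (p i)%:P + (q i)%:P * 'X) k.

Lemma mlineE p q k f t : (mline p q k f).[t] = mev iota (fun i => p i + q i * t) k f.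
Proof.
apply: (@mev_comp _ _ _ _ iota [the {rmorphism {poly L} -> L} of horner_eval t]) => [c|i _] /=.
  by rewrite /horner_eval hornerC.
by rewrite /horner_eval !hornerE.
Qed.

Lemma mline_eq0 p q k f :
  (forall t, t != 0 -> mev iota (fun i => p i + q i * t) k f = 0) -> mev iota p k f = 0.
Proof.
move=> H; have /infL E : forall t, t != 0 -> (mline p q k f).[t] = 0.
  by move=> t t0; rewrite mlineE H.
have := mlineE p q f 0; rewrite E horner0 => ->.
by apply: eq_mev => i _; rewrite mulr0 addr0.
Qed.

Lemma mev_split p k (f : {poly mpoly K k}) y :
  mev iota (fun i => if i == k then y else p i) k.+1 f = (map_poly (mev iota p k) f).[y].
Proof.
rewrite mevS eqxx; congr (_.[_]); apply/polyP => i; rewrite !coef_map /=.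
by apply: eq_mev => j jk; rewrite ltn_eqF.
Qed.

Lemma divn_idx i (w : 'I_n) : ((i * n + w) %/ n = i)%N.
Proof.
have n0 : (0 < n)%N by case: w => w; apply: leq_ltn_trans.
by rewrite divnMDl // divn_small ?addn0.
Qed.

Lemma modn_idx i (w : 'I_n) : ((i * n + w) %% n = w)%N.
Proof. by rewrite modnMDl modn_small. Qed.

Lemma idx_inj i i' (w w' : 'I_n) : (i * n + w = i' * n + w')%N -> i = i' /\ w = w'.
Proof.
move=> E; split; first by rewrite -(divn_idx i w) E divn_idx.
by apply: val_inj; rewrite /= -(modn_idx i w) E modn_idx.
Qed.

(** The variable [k] is no entry of the submatrix in question. Its value is free, so every
    coefficient of [f] in this variable vanishes on the locus. *)
Lemma vanish_free k s (V : {set 'I_n}) (f : {poly mpoly K k}) :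
  (forall i (w : 'I_n), (i < s)%N -> w \in V -> (i * n + w)%N != k) ->
  (forall p, degenerate s V p -> mev iota p k.+1 f = 0) ->
  forall p, degenerate s V p -> mev iota p k (lead_coef f) = 0.
Proof.
move=> Vk f0 p [phi [phi0 H]].
have E : map_poly (mev iota p k) f = 0.
  apply: infL => t _; rewrite -mev_split; apply: f0; exists phi; split=> // w wV.
  rewrite -[RHS](H _ wV); apply: eq_bigr => i _.
  by rewrite (negPf (Vk _ _ (ltn_ord i) wV)).
by rewrite lead_coefE -coef_map E coef0.
Qed.

(** The variable at [(s, w0)] does not occur, so its value may be chosen to extend a relation from
    [V :\ w0] to column [w0]. This requires the relation to have a nonzero coefficient at row
    [s]. *)
Lemma vanish_const k s (V : {set 'I_n}) (w0 : 'I_n) (c : mpoly K k) :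
  w0 \in V -> k = (s * n + w0)%N ->
  (forall p, degenerate s.+1 V p -> mev iota p k.+1 (c%:P : {poly mpoly K k}) = 0) ->
  forall p, degenerate s.+1 (V :\ w0) p -> mev iota p k c = 0.
Proof.
move=> w0V kE f0.
have gen p phi : phi s != 0 ->
    (forall w, w \in V :\ w0 -> \sum_(i < s.+1) phi i * p (i * n + w)%N = 0) ->
    mev iota p k c = 0.
  move=> phis H; pose y := - (\sum_(i < s) phi i * p (i * n + w0)%N) / phi s.
  have := f0 (fun i => if i == k then y else p i).
  rewrite mev_split map_polyC hornerC; apply; exists phi; split; first by exists s.
  move=> w wV; have [->|nw] := eqVneq w w0.
    rewrite big_ord_recr /= kE eqxx /y [phi s * _]mulrC divfK //.
    apply/eqP; rewrite subr_eq0; apply/eqP; apply: eq_bigr => i _.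
    case: eqP => // /idx_inj[E _]; have := ltn_ord i; rewrite E ltnn //.
  rewrite -[RHS](H w) ?inE ?nw //; apply: eq_bigr => i _.
  by rewrite kE; case: eqP => // /idx_inj[_ E]; rewrite E eqxx in nw.
move=> p [phi [[i0 i0s phi0] H]].
have [phis|phis] := eqVneq (phi s) 0; last exact: gen phis H.
(* If the last coordinate of [phi] vanishes, subtract [t] times row [s] from row [i0] to make it
   nonzero. *)
have {}i0s : (i0 < s)%N.
  by rewrite ltn_neqAle -ltnS i0s andbT; apply: contraNneq phi0 => ->; rewrite phis.
pose q x := if (x %/ n == i0)%N then - p (s * n + x %% n)%N else 0.
apply: (@mline_eq0 p q) => t t0.
apply: (gen _ (fun i => if i == s then t * phi i0 else phi i)).
  by rewrite eqxx mulf_neq0.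
move=> w wV; rewrite big_ord_recr /= eqxx /q.
rewrite divn_idx modn_idx (gtn_eqF i0s) mul0r addr0.
have := H w wV; rewrite big_ord_recr /= phis mul0r addr0 => H'.
pose i1 := Ordinal i0s.
transitivity (\sum_(i < s) phi i * p (i * n + w)%N - phi i0 * p (s * n + w)%N * t
   + t * phi i0 * p (s * n + w)%N); last by rewrite H'; ring.
congr (_ + _); rewrite (bigD1 i1) //= [in RHS](bigD1 i1) //=.
rewrite divn_idx modn_idx eqxx (ltn_eqF i0s).
rewrite (eq_bigr (fun i : 'I_s => phi i * p (i * n + w)%N)); first by ring.
move=> i ni; rewrite (ltn_eqF (ltn_ord i)) divn_idx.
have -> : (i == i0 :> nat) = false by apply: contraNF ni => /eqP E; apply/eqP/val_inj.
by rewrite mul0r addr0.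
Qed.

(** The entry [(s, w0)] tends to infinity along a curve inside the degenerate locus; the dominant
    term of [f] on this curve is its leading coefficient at [p]. *)
Lemma vanish_lead k s (V : {set 'I_n}) (w0 : 'I_n) (f : {poly mpoly K k}) :
  w0 \in V -> k = (s * n + w0)%N ->
  (forall p, degenerate s.+1 V p -> mev iota p k.+1 f = 0) ->
  forall p, degenerate s (V :\ w0) p -> mev iota p k (lead_coef f) = 0.
Proof.
move=> w0V kE f0 p [phi [[i0 i0s phi0] H]].
(* With entry (s, w0) equal to 1/t, the matrix whose other columns are corrected by [t] times the
   product of column [w0] and row [s] has the rank of its first [s] rows, plus one. *)
pose q x := if ((x %/ n < s) && (x %% n != w0))%N
            then p ((x %/ n) * n + w0)%N * p (s * n + x %% n)%N else 0.
have curve t : t != 0 -> (map_poly (mev iota (fun x => p x + q x * t) k) f).[t^-1] = 0.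
  move=> t0; rewrite -mev_split; apply: f0.
  (* The coefficient of row [s] cancels column [w0], where it meets the entry [1/t]; what it adds to
     the other columns is cancelled by [q]. *)
  exists (fun i => if i == s then - t * \sum_(i < s) phi i * p (i * n + w0)%N else phi i).
  split; first by exists i0; [exact: ltnW | rewrite ltn_eqF].
  move=> w wV; rewrite big_ord_recr /= eqxx.
  have [->|nw] := eqVneq w w0.
    have tS S : - t * S / t = - S by rewrite mulrAC mulNr divff // mulN1r.
    rewrite kE eqxx tS.
    apply/eqP; rewrite subr_eq0; apply/eqP; apply: eq_bigr => i _.
    rewrite (ltn_eqF (ltn_ord i)); case: eqP => [/idx_inj[E _]|_].
      by have := ltn_ord i; rewrite E ltnn.
    by rewrite /q modn_idx eqxx andbF mul0r addr0.
  have nk i : ((i * n + w)%N == k) = false.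
    by rewrite kE; apply/negP => /eqP/idx_inj[_ E]; rewrite E eqxx in nw.
  rewrite nk {2}/q divn_idx ltnn mul0r addr0.
  rewrite -[RHS](H w) ?inE ?nw //.
  rewrite (eq_bigr (fun i : 'I_s => phi i * p (i * n + w)%N +
      phi i * p (i * n + w0)%N * (t * p (s * n + w)%N))); last first.
    move=> i _; rewrite nk (ltn_eqF (ltn_ord i)) /q divn_idx modn_idx ltn_ord nw /=.
    by ring.
  by rewrite big_split /= -mulr_suml; ring.
pose d := (size f).-1.
have led (e : 'I_(size f)) : (e <= d)%N by rewrite -ltnS prednK // (leq_ltn_trans _ (ltn_ord e)).
(* [G] is the value of [f] on the curve multiplied by [t ^ d], which clears the poles. It vanishes
   for all nonzero [t], hence also at 0, where only the top coefficient survives. *)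
pose G := \sum_(e < size f) 'X^(d - e) * mline p q k f`_e.
have G0 : G = 0.
  apply: infL => t t0; rewrite /G horner_sum.
  transitivity (t ^+ d * (map_poly (mev iota (fun x => p x + q x * t) k) f).[t^-1]).
    rewrite (@horner_coef_wide _ (size f)) ?size_poly // mulr_sumr.
    apply: eq_bigr => e _; rewrite hornerM hornerXn mlineE coef_map /=.
    have ed := led e.
    rewrite [RHS]mulrCA [LHS]mulrC; congr (_ * _).
    by rewrite exprVn -{2}(subnK ed) exprD mulfK // expf_neq0.
  by rewrite curve // mulr0.
have [->|fn0] := eqVneq f 0; first by rewrite lead_coef0 rmorph0.
have := congr1 (fun g => g.[0]) G0; rewrite /G horner_sum horner0.
have sf : (d < size f)%N by rewrite /d prednK // size_poly_gt0.
rewrite (bigD1 (Ordinal sf)) //= subnn expr0 mul1r mlineE big1 ?addr0 => [E|e ne].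
  rewrite lead_coefE -[RHS]E; apply: eq_mev => i _; by rewrite mulr0 addr0.
have ed : (e < d)%N.
  rewrite ltn_neqAle; apply/andP; split.
    by apply: contraNneq ne => E; apply/eqP/val_inj.
  exact: led.
by rewrite hornerM hornerXn expr0n subn_eq0 leqNgt ed mul0r.
Qed.

(** Induction on the number of variables. The last one is outside the submatrix, or is absent from
    [f] and its column is dropped, or occurs in [f] and supplies the last diagonal entry, leaving
    one row less. *)
Lemma lme_degenerate k s (V : {set 'I_n}) (f : mpoly K k) :
  (forall w, w \in V -> (s.-1 * n + w < k)%N) -> f != 0 ->
  (forall p, degenerate s V p -> mev iota p k f = 0) -> has_diag s V (lme f).
Proof.
elim: k s V f => [|k IH] [|s] V f Vk f0 van;
  try by exists (fun i : 'I_0 => match notF (ltn_ord i) with end); split=> [[]|[]|[]].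
  have dg0 : degenerate s.+1 V (fun=> 0 : L).
    exists (fun=> 1); split; first by exists 0%N; rewrite ?oner_neq0.
    by move=> w _; rewrite big1 // => i _; rewrite mulr0.
  by have /eqP := van _ dg0; rewrite fmorph_eq0 (negPf f0).
have l0 : lead_coef (f : {poly mpoly K k}) != 0 by rewrite -mpoly_eq0.
have [w0 /andP[w0V /eqP w0k]|nV] := pickP [pred w in V | (s * n + w)%N == k]; last first.
  have Vk' i (w : 'I_n) : (i < s.+1)%N -> w \in V -> (i * n + w)%N != k.
    move=> si wV; apply/eqP => E; have /= := Vk w wV; have := nV w; rewrite /= wV /=.
    move/negbT/eqP; nia.
  have [|a [a1 a2 a3]] := IH s.+1 V _ _ l0 (vanish_free Vk' van).
    by move=> w wV; have := Vk w wV; have := Vk' s w (ltnSn s) wV; rewrite /=; lia.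
  by exists a; split=> // i; rewrite /= (negPf (Vk' _ _ _ _)).
have Vw w : w \in V :\ w0 -> (s * n + w < k)%N.
  rewrite !inE => /andP[/eqP nw /Vk /=]; rewrite ltnS leq_eqVlt => /orP[/eqP E|//].
  by case: nw; move: E; rewrite -w0k => /idx_inj[].
have [d0|d0] := posnP (size (f : {poly mpoly K k})).-1.
  have fC : f = (lead_coef (f : {poly mpoly K k}))%:P :> {poly mpoly K k}.
    by rewrite lead_coefE d0; apply: size1_polyC; lia.
  have van' p : degenerate s.+1 V p ->
      mev iota p k.+1 ((lead_coef (f : {poly mpoly K k}))%:P : {poly mpoly K k}) = 0.
    by rewrite -fC; exact: van.
  have [|a [a1 a2 a3]] := IH s.+1 (V :\ w0) _ _ l0 (vanish_const w0V (esym w0k) van').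
    by move=> w /Vw; rewrite /=.
  exists a; split=> // i; first by have := a2 i; rewrite inE => /andP[].
  have := Vw _ (a2 i) => lt; rewrite /= ltn_eqF //.
  by have := ltn_ord i; nia.
have [|a [a1 a2 a3]] := IH s (V :\ w0) _ _ l0 (vanish_lead w0V (esym w0k) van).
  by move=> w /Vw; nia.
have aw i : (a i < w0)%N by have := Vw _ (a2 i); lia.
exists (fun i => if unlift ord_max i is Some j then a j else w0); split.
- move=> i j; case: unliftP => [i' ->|->]; case: unliftP => [j' ->|->].
  + by rewrite !lift_max; exact: a1.
  + by move=> _; exact: aw.
  + by rewrite lift_max ltnNge ltnW.
  + by rewrite ltnn.
- by move=> i; case: unliftP => // j _; have := a2 j; rewrite inE => /andP[].
move=> i; case: unliftP => [j ->|->]; last by rewrite /= w0k eqxx.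
rewrite lift_max /= ltn_eqF //.
by apply: leq_ltn_trans (Vw _ (a2 j)); rewrite leq_add2r leq_mul2r (ltnW (ltn_ord j)) orbT.
Qed.
End DegenerateLocus.

(** In [K(X)] the powers of [X] are distinct and nonzero, and give more roots than the degree of [q]
    allows. This covers finite [K]. *)
Lemma infinite_extension (K : fieldType) : exists (L : fieldType) (_ : {rmorphism K -> L}),
  forall q : {poly L}, (forall t, t != 0 -> q.[t] = 0) -> q = 0.
Proof.
exists {fraction {poly K}}, [the {rmorphism K -> {fraction {poly K}}} of
   (@tofrac {poly K} \o polyC)] => q H.
apply/eqP; apply: contraT => q0.
pose rs : seq {fraction {poly K}} := [seq tofrac ('X^i) | i <- iota 0 (size q)].
have := @max_poly_roots _ q rs q0; rewrite size_map size_iota ltnn; apply.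
  apply/allP => _ /mapP[i _ ->]; apply/eqP/H.
  by rewrite tofrac_eq0 -size_poly_gt0 size_polyXn.
rewrite map_inj_uniq ?iota_uniq // => i j /eqP; rewrite tofrac_eq => /eqP E.
by have := congr1 (fun p : {poly K} => size p) E; rewrite !size_polyXn => -[].
Qed.

(** * Ideals of maximal minors *)

(** Linear combinations are built one term at a time, so membership supports induction and the
    generators may form any predicate. *)
Inductive igen (R : comNzRingType) (G : R -> Prop) : R -> Prop :=
| igen0 : igen G 0
| igenD r g f : G g -> igen G f -> igen G (r * g + f).

Section Igen.
Variable R : comNzRingType.
Implicit Types (G H : R -> Prop).

Lemma igen_ideal G : ideal (igen G).
Proof.
split=> [|a b Ia Ib|r b]; first exact: igen0.
  elim: Ia => [|r g f Gg _ IH]; first by rewrite add0r.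
  by rewrite -addrA; apply: igenD.
elim=> [|r' g f Gg _ IH]; first by rewrite mulr0; exact: igen0.
by rewrite mulrDr mulrA; apply: igenD.
Qed.

Lemma igen_sub G : forall g, G g -> igen G g.
Proof. by move=> g Gg; rewrite -[g]mul1r -[1 * g]addr0; apply: igenD Gg (igen0 _). Qed.

Lemma igen_map (R' : comNzRingType) (phi : {rmorphism R -> R'}) G (I : R' -> Prop) :
  ideal I -> (forall g, G g -> I (phi g)) -> forall f, igen G f -> I (phi f).
Proof.
move=> [I0 ID IM] GI f; elim=> [|r g h /GI Ig _ Ih]; first by rewrite rmorph0.
by rewrite rmorphD rmorphM; apply: ID => //; apply: IM.
Qed.

Lemma igen_min G (I : R -> Prop) :
  ideal I -> (forall g, G g -> I g) -> forall f, igen G f -> I f.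
Proof. exact: (@igen_map R [the {rmorphism R -> R} of idfun]). Qed.
End Igen.

Section MinorIdeals.
Variables (K : fieldType) (m n : nat).
Implicit Types (C D : {set 'I_n}) (Cs : seq {set 'I_n}).

Definition topminor t (a : 'I_t -> 'I_n) : mpoly K (m * n) :=
  \det (varmx K (m * n) n (fun i : 'I_t => i) (fun j => a j)).

(** Arbitrary tuples of columns are allowed, not only increasing ones; this makes the generators
    stable under column permutations. *)
Definition clique_gen C g := exists2 a : 'I_m -> 'I_n, forall j, a j \in C & g = topminor a.
Definition cliques_gen Cs g := exists2 C, C \in Cs & clique_gen C g.

Definition increasing t (a : 'I_t -> 'I_n) := forall i j : 'I_t, (i < j)%N -> (a i < a j)%N.

Definition clique_diag C g := exists a : 'I_m -> 'I_n,
  [/\ increasing a, forall j, a j \in C & g = topminor a].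

Lemma cliques_gen_nil f : igen (cliques_gen [::]) f -> f = 0.
Proof. by elim=> // r g h []. Qed.

Lemma cliques_gen_cons C Cs f : igen (cliques_gen (C :: Cs)) f <->
  ideal_sum (igen (clique_gen C)) (igen (cliques_gen Cs)) f.
Proof.
split.
  apply: igen_min; first by apply: ideal_sumP; exact: igen_ideal.
  move=> g [D]; rewrite inE => /orP[/eqP-> Dg|DCs Dg].
    by exists g, 0; rewrite addr0; split=> //; [exact: igen_sub | exact: igen0].
  exists 0, g; rewrite add0r; split=> //; [exact: igen0 | apply: igen_sub].
  by exists D.
have [_ JD _] := igen_ideal (cliques_gen (C :: Cs)).
move=> [a [b [Ia Ib ->]]]; apply: JD.
  apply: igen_min Ia; first exact: igen_ideal.
  by move=> g Cg; apply: igen_sub; exists C; rewrite ?mem_head.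
apply: igen_min Ib; first exact: igen_ideal.
by move=> g [D DCs Dg]; apply: igen_sub; exists D; rewrite // inE DCs orbT.
Qed.

Lemma idx_lt i (w : 'I_n) : (i < m)%N -> (i * n + w < m * n)%N.
Proof. by move=> im; have := ltn_ord w; nia. Qed.

Lemma lme_topminor t (a : 'I_t -> 'I_n) : (t <= m)%N -> increasing a ->
  topminor a != 0 /\ forall x, lme (topminor a) x = (\sum_(i < t) (x == i * n + a i))%N.
Proof.
move=> tm ainc; apply: lme_det_varmx => // i j.
by apply: idx_lt; apply: leq_trans tm.
Qed.

Lemma topminor_coprime s t (a : 'I_s -> 'I_n) (b : 'I_t -> 'I_n) :
  (s <= m)%N -> (t <= m)%N -> increasing a -> increasing b ->
  (forall (i : 'I_s) (j : 'I_t), i = j :> nat -> a i != b j) ->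
  lme_coprime (topminor a) (topminor b).
Proof.
move=> sm tm ainc binc ab x; rewrite (lme_topminor sm ainc).2 (lme_topminor tm binc).2.
have [/existsP[i /eqP xi]|/existsPn H] := boolP [exists i : 'I_s, x == i * n + a i]%N; last first.
  by left; apply: big1 => i _; rewrite (negPf (H i)).
right; apply: big1 => j _; case: eqP => // xj; move: xi; rewrite xj => E.
by have [ij ba] := idx_inj E; have := ab _ _ (esym ij); rewrite ba eqxx.
Qed.

Lemma mev_topminor (L : comNzRingType) (iota : {rmorphism K -> L}) p t (a : 'I_t -> 'I_n) :
  (t <= m)%N -> mev iota p (m * n) (topminor a) =
  \det (\matrix_(i < t, j < t) p (i * n + a j)%N).
Proof.
move=> tm; rewrite -det_map_mx; congr (\det _); apply/matrixP => i j.
by rewrite !mxE mev_var // idx_lt // (leq_trans _ tm).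
Qed.

Lemma degenerate_vanish (L : fieldType) (iota : {rmorphism K -> L}) C p f :
  degenerate m C p -> igen (clique_gen C) f -> mev iota p (m * n) f = 0.
Proof.
move=> [phi [[i0 i0m phi0] H]]; elim=> [|r g h [a aC ->] _ IH]; first by rewrite rmorph0.
rewrite rmorphD rmorphM IH addr0 mev_topminor //.
rewrite (_ : \det _ = 0) ?mulr0 //; apply/eqP/det0P.
exists (\row_i phi i).
  by apply: contraNneq phi0 => /rowP/(_ (Ordinal i0m)); rewrite !mxE => ->.
apply/rowP => j; rewrite !mxE -[RHS](H (a j)) //.
by apply: eq_bigr => i _; rewrite !mxE.
Qed.

Hypothesis m_gt0 : (0 < m)%N.

Lemma groebner_clique C : groebner (igen (clique_gen C)) (clique_diag C).
Proof.
split; first exact: igen_ideal.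
  move=> g [a [ainc aC ->]]; split; last exact: (lme_topminor (leqnn m) ainc).1.
  by apply: igen_sub; exists a.
move=> f If f0; have [L [iota infL]] := infinite_extension K.
have [||a [a1 a2 a3]] := @lme_degenerate K L iota n infL (m * n) m C f _ f0.
- by move=> w _; apply: idx_lt; rewrite prednK.
- by move=> p /degenerate_vanish; apply.
exists (topminor a); first by exists a.
move=> x; rewrite (lme_topminor (leqnn m) a1).2.
have [/existsP[i /eqP xi]|/existsPn H] := boolP [exists i : 'I_m, x == i * n + a i]%N; last first.
  by rewrite big1 // => i _; rewrite (negPf (H i)).
(* Distinct rows have distinct variables, so a diagonal monomial has exponents at most 1 and
   positivity of the exponents of [f] is enough. *)
apply: leq_trans (_ : 1 <= _)%N; last by rewrite xi.
rewrite (bigD1 i) //= -xi eqxx big1 // => j ji; case: eqP => //.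
by rewrite xi => /idx_inj[/val_inj E]; rewrite E eqxx in ji.
Qed.

(** The combinatorial form of coprimality between the leading monomials of two cliques. *)
Definition diag_disjoint C D := forall a b : 'I_m -> 'I_n, increasing a -> increasing b ->
  (forall j, a j \in C) -> (forall j, b j \in D) -> forall i, a i != b i.

Lemma groebner_cliques Cs : uniq Cs ->
  (forall C D, C \in Cs -> D \in Cs -> C != D -> diag_disjoint C D) ->
  groebner (igen (cliques_gen Cs)) (fun g => exists2 C, C \in Cs & clique_diag C g).
Proof.
elim: Cs => [|C Cs IH] /=.
  split; [exact: igen_ideal | by move=> g [] | by move=> f /cliques_gen_nil ->; rewrite eqxx].
move=> /andP[CCs uCs] dis.
have [||_ D2 D3] := @groebner_sum K (m * n) _ _ _ _ (groebner_clique C) (IH uCs _).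
- by move=> D E DCs ECs; apply: dis; rewrite inE ?DCs ?ECs orbT.
- move=> g h [a [ainc aC ->]] [D DCs [b [binc bD ->]]].
  apply: topminor_coprime => // i j /val_inj <-; apply: (dis C D) => //.
  + exact: mem_head.
  + by rewrite inE DCs orbT.
  + by apply: contraNneq CCs => ->.
split; first exact: igen_ideal.
  move=> g [D]; rewrite inE => /orP[/eqP -> Cg|DCs Dg].
    by have [Ig g0] := D2 g (or_introl Cg); split=> //; apply/cliques_gen_cons.
  have [|Ig g0] := D2 g; first by right; exists D.
  by split=> //; apply/cliques_gen_cons.
move=> f /cliques_gen_cons If f0; have [g [Cg|[D DCs Dg]] gf] := D3 f If f0; exists g => //.
  by exists C; rewrite ?mem_head.
by exists D; rewrite // inE DCs orbT.
Qed.

Lemma topminor_regular Cs t (b : 'I_t -> 'I_n) : uniq Cs ->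
  (forall C D, C \in Cs -> D \in Cs -> C != D -> diag_disjoint C D) ->
  (t <= m)%N -> increasing b ->
  (forall D, D \in Cs -> forall a : 'I_m -> 'I_n, increasing a -> (forall j, a j \in D) ->
     forall (i : 'I_t) (j : 'I_m), i = j :> nat -> b i != a j) ->
  forall f, igen (cliques_gen Cs) (topminor b * f) -> igen (cliques_gen Cs) f.
Proof.
move=> uCs dis tm binc bD; apply: groebner_regular (groebner_cliques uCs dis) _ _.
  exact: (lme_topminor tm binc).1.
move=> _ [D DCs [a [ainc aD ->]]].
by apply: topminor_coprime => //; exact: bD aD.
Qed.
End MinorIdeals.
Arguments clique_gen K m {n} C g.
Arguments cliques_gen K m {n} Cs g.

(** * Generic points *)

Section ColumnPermutation.
Variables (K : fieldType) (m n : nat).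
Implicit Types (s : {perm 'I_n}) (Cs : seq {set 'I_n}).

(** The column of a variable is its index modulo [n]. The default 0 is reached only for [n = 0],
    when there are no variables. *)
Definition colperm s : {rmorphism mpoly K (m * n) -> mpoly K (m * n)} :=
  mev (mconst K (m * n)) (fun x =>
    if insub (x %% n)%N is Some w then mvar K (m * n) (x %/ n * n + s w) else 0) (m * n).

Lemma colperm_topminor s t (a : 'I_t -> 'I_n) : (t <= m)%N ->
  colperm s (topminor K m a) = topminor K m (s \o a).
Proof.
move=> tm; rewrite /colperm mev_topminor //; congr (\det _); apply/matrixP => i j.
by rewrite !mxE modn_idx divn_idx valK.
Qed.

Lemma colpermK s : cancel (colperm s) (colperm s^-1).
Proof.
elim/mpoly_ind => [c|x lx|f g Ef Eg|f g Ef Eg].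
- by rewrite /colperm !mev_const.
- have n0 : (0 < n)%N by case: (n) lx => //; rewrite muln0.
  have [w ->] : exists w : 'I_n, x = (x %/ n * n + w)%N.
    by exists (Ordinal (ltn_pmod x n0)); rewrite /= -divn_eq.
  have xm : (x %/ n < m)%N by rewrite ltn_divLR.
  rewrite /colperm mev_var ?idx_lt // modn_idx divn_idx valK.
  by rewrite mev_var ?idx_lt // modn_idx divn_idx valK permK.
- by rewrite !rmorphD /= Ef Eg.
- by rewrite !rmorphM /= Ef Eg.
Qed.

Lemma colperm_ideal s Cs f : igen (cliques_gen K m Cs) f ->
  igen (cliques_gen K m [seq s @: (C : {set 'I_n}) | C <- Cs]) (colperm s f).
Proof.
apply: igen_map; first exact: igen_ideal.
move=> _ [C CCs [a aC ->]]; rewrite colperm_topminor //; apply: igen_sub.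
exists (s @: C); first exact: map_f.
by exists (s \o a) => // j; apply: imset_f.
Qed.

(** Regularity does not depend on the labelling: it is proved after moving the columns by [s] and
    carried back by the inverse permutation. *)
Lemma topminor_regular_perm s Cs t (b : 'I_t -> 'I_n) : (0 < m)%N -> uniq Cs ->
  (forall C D, C \in Cs -> D \in Cs -> C != D -> diag_disjoint m (s @: C) (s @: D)) ->
  (t <= m)%N -> increasing (s \o b) ->
  (forall D, D \in Cs -> forall a : 'I_m -> 'I_n, increasing a -> (forall j, a j \in s @: D) ->
     forall (i : 'I_t) (j : 'I_m), i = j :> nat -> s (b i) != a j) ->
  forall f, igen (cliques_gen K m Cs) (topminor K m b * f) -> igen (cliques_gen K m Cs) f.
Proof.
move=> m0 uCs dis tm binc bD f /(colperm_ideal s).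
rewrite rmorphM /= colperm_topminor //.
set Cs' := map _ _ => H.
have: igen (cliques_gen K m Cs') (colperm s f).
  apply: topminor_regular H => //.
  - by rewrite map_inj_uniq //; apply: imset_inj; exact: perm_inj.
  - move=> _ _ /mapP[C CCs ->] /mapP[D DCs ->] CD; apply: dis => //.
    by apply: contraNneq CD => ->.
  - by move=> _ /mapP[D DCs ->]; exact: bD.
move/(colperm_ideal s^-1); rewrite colpermK /Cs' -map_comp.
rewrite (eq_map (g := id)) ?map_id // => C /=.
by rewrite -imset_comp -[RHS]imset_id; apply: eq_imset => w /=; rewrite permK.
Qed.
End ColumnPermutation.

(** Each variable is sent to a new transcendental, adjoined by passing to the fraction field of
    [E[X]]. *)
Lemma generic_point (K : fieldType) k :
  exists (E : fieldType) (iota : {rmorphism K -> E}) (p : nat -> E),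
  forall f : mpoly K k, mev iota p k f = 0 -> f = 0.
Proof.
elim: k => [|k [E [iota [p H]]]].
  by exists K, [the {rmorphism K -> K} of idfun], (fun=> 0).
pose g : {rmorphism E -> {fraction {poly E}}} :=
  [the {rmorphism _ -> _} of (@tofrac {poly E} \o polyC)].
exists {fraction {poly E}}, [the {rmorphism K -> {fraction {poly E}}} of (g \o iota)].
exists (fun i => if i == k then tofrac 'X else g (p i)) => f.
have -> : mev [the {rmorphism K -> {fraction {poly E}}} of (g \o iota)]
   (fun i => if i == k then tofrac 'X else g (p i)) k.+1 f =
   tofrac (map_poly (mev iota p k) (f : {poly mpoly K k})).
  rewrite mevS eqxx -[map_poly (mev iota p k) _ in RHS]comp_polyXr /comp_poly.
  rewrite -[in RHS]horner_map /= -!map_poly_comp; congr (_.[_]).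
  apply: eq_map_poly => c /=.
  rewrite -[RHS]/(g (mev iota p k c)); symmetry; apply: mev_comp => // i ik.
  by rewrite ltn_eqF.
move/eqP; rewrite tofrac_eq0 => /eqP E0; apply/polyP => i.
by rewrite coef0; apply: H; rewrite -coef_map E0 coef0.
Qed.

Definition has_generic_point (K : fieldType) m n
    (I : mpoly K (m * n) -> Prop) : Prop :=
  exists (E : fieldType) (iota : {rmorphism K -> E}) (p : nat -> E),
    forall f, I f <-> mev iota p (m * n) f = 0.

(** * Extending a generic point by one clique *)

Section GenericExtension.
Variables (K : fieldType) (m n : nat).
Notation S := (mpoly K (m.+1 * n)).
Variables (C : {set 'I_n}) (Cs : seq {set 'I_n}) (b : 'I_m -> 'I_n).
Hypothesis bC : forall j, b j \in C.
Hypothesis CsC : forall D w, D \in Cs -> w \in D -> w \in C -> exists j, w = b j.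

Let J := igen (cliques_gen K m.+1 (C :: Cs)).
Let J' := igen (cliques_gen K m.+1 Cs).
Let gamma : S := topminor K m.+1 b.
Hypothesis gamma_regular : forall f : S, J (gamma * f) -> J f.

Variables (E : fieldType) (iota : {rmorphism K -> E}) (p' : nat -> E).
Hypothesis p'P : forall f, J' f <-> mev iota p' (m.+1 * n) f = 0.

Let xv (i : nat) (w : 'I_n) : S := mvar K (m.+1 * n) (i * n + w).

(** These are the cofactors of a last column appended to the columns [b]; the one of the last row is
    [gamma]. *)
Let cof (i : 'I_m.+1) : S :=
  (-1) ^+ (i + m) * \det (\matrix_(i' < m, j < m) xv (lift i i') (b j)).

Let bext (w : 'I_n) (j : 'I_m.+1) := if unlift ord_max j is Some j' then b j' else w.

Lemma cof_max : cof ord_max = gamma.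
Proof.
rewrite /cof -signr_odd oddD addbb expr0 mul1r; congr (\det _).
by apply/matrixP => i j; rewrite !mxE /xv lift_max.
Qed.

Lemma cof_rel w : \sum_(i < m.+1) xv i w * cof i = topminor K m.+1 (bext w).
Proof.
rewrite /topminor (expand_det_col _ ord_max); apply: eq_bigr => i _.
rewrite mxE /bext unlift_none /cofactor /cof; congr (_ * (_ * \det _)).
by apply/matrixP => i' j'; rewrite !mxE liftK.
Qed.

Lemma cof_rel_b j : \sum_(i < m.+1) xv i (b j) * cof i = 0.
Proof.
rewrite cof_rel /topminor -det_tr.
apply: (@determinant_alternate _ _ _ ord_max (lift ord_max j)).
  by rewrite neq_lift.
by move=> i; rewrite !mxE /bext unlift_none liftK.
Qed.

Lemma cof_relJ w : w \in C -> J (\sum_(i < m.+1) xv i w * cof i).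
Proof.
move=> wC; rewrite cof_rel; apply: igen_sub; exists C; first exact: mem_head.
by exists (bext w) => // j; rewrite /bext; case: unliftP.
Qed.

Let solved w := (w \in C) && [forall j, w != b j].
Let phi (i : nat) : E := mev iota p' _ (cof (inord i)).
(** Only the last entries of the columns of [C] outside [b] change; they are solved for so that
    [phi] annihilates these columns. *)
Let p (x : nat) : E :=
  if insub (x %% n)%N is Some w then
    if (x %/ n == m)%N && solved w
    then - (\sum_(i < m) phi i * p' (i * n + w)%N) / phi m else p' x
  else p' x.

Lemma pE i (w : 'I_n) : p (i * n + w)%N =
  if (i == m) && solved w then - (\sum_(i < m) phi i * p' (i * n + w)%N) / phi m
  else p' (i * n + w)%N.
Proof. by rewrite /p modn_idx divn_idx valK. Qed.

Lemma p_cof i : mev iota p _ (cof i) = mev iota p' _ (cof i).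
Proof.
rewrite /cof !rmorphM !rmorph_sign -!det_map_mx /=; congr (_ * \det _).
have li (i' : 'I_m) : (bump i i' < m.+1)%N by exact: ltn_ord (lift i i').
apply/matrixP => i' j; rewrite !mxE !mev_var ?idx_lt // pE.
by rewrite /solved (_ : [forall _, _] = false) ?andbF //; apply/forallP => /(_ j); rewrite eqxx.
Qed.

Lemma J_neq1 : ~ J 1.
Proof.
move=> J1; suff /eqP : mev [the {rmorphism K -> K} of idfun] (fun=> 0) (m.+1 * n) 1 = 0.
  by rewrite rmorph1 oner_eq0.
elim: J1 => [|r g f [D _ [a _ ->]] _ IH]; first by rewrite rmorph0.
rewrite rmorphD rmorphM IH addr0 mev_topminor //.
rewrite (_ : \matrix_(_, _) _ = 0) ?det0 ?mulr0 //.
by apply/matrixP => i j; rewrite !mxE.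
Qed.

Lemma J'_J f : J' f -> J f.
Proof.
apply: igen_min; first exact: igen_ideal.
by move=> g [D DCs Dg]; apply: igen_sub; exists D; rewrite // inE DCs orbT.
Qed.

(** If [gamma] vanished at [p'], it would lie in [J'], hence in [J], and regularity would put 1 into
    [J]. *)
Lemma phi_neq0 : phi m != 0.
Proof.
apply/eqP => /p'P; rewrite (_ : inord m = ord_max) ?cof_max; last first.
  by apply: val_inj; rewrite /= inordK.
by rewrite -[gamma]mulr1 => /J'_J /gamma_regular; exact: J_neq1.
Qed.

Lemma p_degenerate : degenerate m.+1 C p.
Proof.
exists phi; split; first by exists m => //; exact: phi_neq0.
move=> w wC; have [sw|] := boolP (solved w).
  rewrite big_ord_recr /= pE eqxx sw [phi m * _]mulrC divfK ?phi_neq0 //.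
  apply/eqP; rewrite subr_eq0; apply/eqP; apply: eq_bigr => i _.
  by rewrite pE ltn_eqF.
move=> nsw; have := nsw; rewrite /solved wC /= negb_forall => /existsP[j /negbNE/eqP wb].
have := congr1 (mev iota p' _) (cof_rel_b j).
rewrite -wb rmorph_sum rmorph0 => H; rewrite -[RHS]H; apply: eq_bigr => i _.
by rewrite pE (negPf nsw) andbF rmorphM mev_var ?idx_lt // /phi inord_val mulrC.
Qed.

Lemma p_vanish f : J f -> mev iota p _ f = 0.
Proof.
move=> /cliques_gen_cons[f1 [f2 [J1 J2 ->]]]; rewrite rmorphD.
rewrite (degenerate_vanish _ p_degenerate J1) add0r.
elim: J2 => [|r g h [D DCs [a aD gE]] _ IH]; first by rewrite rmorph0.
rewrite rmorphD rmorphM IH addr0 gE.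
have /p'P : J' (topminor K m.+1 a) by apply: igen_sub; exists D => //; exists a.
rewrite !mev_topminor // => E0.
rewrite [\det _](_ : _ = 0) ?mulr0 // -[RHS]E0; congr (\det _).
(* The vertices that other cliques share with [C] are among [b], so their columns are the same at
   [p] and [p']. *)
apply/matrixP => i j; rewrite !mxE pE; case: ifP => // /andP[_ /andP[aC /forallP nb]].
by have [j' E'] := CsC DCs (aD j) aC; have := nb j'; rewrite E' eqxx.
Qed.

(* [f'] avoids the entries of the last row at which [p] and [p'] differ. *)
Lemma eliminate f : exists k f', J (gamma ^+ k * f - f') /\ mev iota p _ f' = mev iota p' _ f'.
Proof.
have [J0 JD JM] : ideal J := igen_ideal _.
have pg : mev iota p _ gamma = mev iota p' _ gamma by rewrite -cof_max p_cof.
elim/mpoly_ind: f => [c|x lx|f g [k1 [f1 [Jf pf]]] [k2 [g1 [Jg pg1]]]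
                           |f g [k1 [f1 [Jf pf]]] [k2 [g1 [Jg pg1]]]].
- by exists 0%N, (mconst _ _ c); rewrite mul1r subrr !mev_const.
- have n0 : (0 < n)%N by case: (n) lx => //; rewrite muln0.
  have [w ->] : exists w : 'I_n, x = (x %/ n * n + w)%N.
    by exists (Ordinal (ltn_pmod x n0)); rewrite /= -divn_eq.
  have xm : (x %/ n < m.+1)%N by rewrite ltn_divLR.
  have [/andP[/eqP -> sw]|nsw] := boolP ((x %/ n == m)%N && solved w); last first.
    exists 0%N, (mvar _ _ (x %/ n * n + w)); rewrite mul1r subrr; split=> //.
    by rewrite !mev_var ?idx_lt // pE (negPf nsw).
  (* Modulo [J] the cofactor relation expresses [gamma] times the last entry of column [w] by
     entries above it. *)
  exists 1%N, (- \sum_(i < m) xv i w * cof (widen_ord (leqnSn m) i)); split.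
    have /andP[/cof_relJ + _] := sw.
    by rewrite big_ord_recr /= cof_max opprK addrC mulrC.
  rewrite !rmorphN !rmorph_sum; congr (- _); apply: eq_bigr => i _.
  have im := ltnW (ltn_ord i).
  by rewrite [LHS]rmorphM [RHS]rmorphM p_cof !mev_var ?idx_lt // pE ltn_eqF.
- exists (k1 + k2)%N, (gamma ^+ k2 * f1 + gamma ^+ k1 * g1); split.
    rewrite (_ : _ - _ = gamma ^+ k2 * (gamma ^+ k1 * f - f1) +
       gamma ^+ k1 * (gamma ^+ k2 * g - g1)); first by apply: JD; apply: JM.
    by rewrite exprD; ring.
  by rewrite !rmorphD !rmorphM !rmorphXn /= pf pg1 pg.
exists (k1 + k2)%N, (f1 * g1); split.
  rewrite (_ : _ - _ = gamma ^+ k2 * g * (gamma ^+ k1 * f - f1) +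
     f1 * (gamma ^+ k2 * g - g1)); first by apply: JD; apply: JM.
  by rewrite exprD; ring.
by rewrite !rmorphM pf pg1.
Qed.

(** If [f] vanishes at [p], the polynomial [f'] obtained by elimination vanishes at [p'], so it lies
    in [J'] and hence in [J]; regularity then removes the power of [gamma]. *)
Lemma generic_extension f : J f <-> mev iota p (m.+1 * n) f = 0.
Proof.
split; first exact: p_vanish.
move=> pf; have [k [f' [Jff' pf']]] := eliminate f.
have Jf' : J f'.
  apply/J'_J/p'P; rewrite -pf'; have := p_vanish Jff'.
  by rewrite rmorphB rmorphM pf mulr0 sub0r => /eqP; rewrite oppr_eq0 => /eqP.
have {Jff' Jf'} : J (gamma ^+ k * f).
  rewrite -(subrK f' (_ * _)).
  by have [_ JD _] := igen_ideal (cliques_gen K m.+1 (C :: Cs)); apply: JD.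
elim: k => [|k IH]; first by rewrite mul1r.
by rewrite exprS -mulrA => /gamma_regular.
Qed.
End GenericExtension.

(** * Positions of vertices *)

Section Positions.
Variable n : nat.
Implicit Types (A B F : {set 'I_n}) (x y : 'I_n) (s : {perm 'I_n}).

Definition lowN A x := #|[set w in A | (w < x)%N]|.
Definition highN A x := #|[set w in A | (x < w)%N]|.

Lemma lowN_highN A x : x \in A -> (lowN A x + highN A x).+1 = #|A|.
Proof.
move=> xA; rewrite (cardsD1 x) xA add1n; congr _.+1.
rewrite -(cardsID [set w : 'I_n | (w < x)%N] (A :\ x)); congr (_ + _)%N; apply: eq_card => w;
  rewrite !inE -val_eqE /=; case: (w \in A); rewrite ?andbF ?andbT //=; case: ltngtP => //=.
Qed.

Lemma increasing_inj t (a : 'I_t -> 'I_n) : increasing a -> injective a.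
Proof.
move=> ainc i j aij; apply/val_inj; have [/ainc|/ainc|//] := ltngtP i j;
by rewrite aij ltnn.
Qed.

Lemma increasing_lowN t (a : 'I_t -> 'I_n) A (i : 'I_t) : increasing a -> (forall j, a j \in A) ->
  (i <= lowN A (a i))%N.
Proof.
move=> ainc aA; pose f (j : 'I_i) := a (widen_ord (ltnW (ltn_ord i)) j).
have finj : injective f by move=> j k /(increasing_inj ainc)/(congr1 val)/= /val_inj.
rewrite -[X in (X <= _)%N]card_ord -(card_imset _ finj) subset_leq_card //.
by apply/subsetP => _ /imsetP[j _ ->]; rewrite inE aA /=; apply: ainc; rewrite /= ltn_ord.
Qed.

Lemma increasing_highN t (a : 'I_t -> 'I_n) A (i : 'I_t) : increasing a -> (forall j, a j \in A) ->
  (t.-1 - i <= highN A (a i))%N.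
Proof.
move=> ainc aA.
have lt (j : 'I_(t.-1 - i)) : (i + j.+1 < t)%N by have := ltn_ord j; have := ltn_ord i; lia.
pose f j := a (Ordinal (lt j)).
have finj : injective f.
  move=> j k /(increasing_inj ainc)/(congr1 val)/= /eqP; rewrite eqn_add2l => /eqP[E].
  exact: val_inj.
rewrite -[X in (X <= _)%N]card_ord -(card_imset _ finj) subset_leq_card //.
by apply/subsetP => _ /imsetP[j _ ->]; rewrite inE aA /=; apply: ainc => /=; lia.
Qed.

Lemma increasing_enum A : exists a : 'I_#|A| -> 'I_n,
  [/\ increasing a, forall j, a j \in A & forall x, x \in A -> exists j, x = a j].
Proof.
pose l := sort (fun x y : 'I_n => (x <= y)%N) (enum A).
have sl : size l = #|A| by rewrite size_sort cardE.
have lA x : (x \in l) = (x \in A) by rewrite mem_sort mem_enum.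
have ul : uniq l by rewrite sort_uniq enum_uniq.
have [x0 _|A0] := pickP [pred x | x \in A]; last first.
  have cA : #|A| = 0%N by apply: eq_card0.
  rewrite cA; exists (fun j : 'I_0 => match notF (ltn_ord j) with end).
  by split=> [[]|[]|x xA] //; have := A0 x; rewrite /= xA.
have sortl : sorted (fun x y : 'I_n => (x <= y)%N) l.
  by apply: sort_sorted => x y; exact: leq_total.
exists (fun j => nth x0 l j); split.
- move=> i j ij; rewrite ltn_neqAle; apply/andP; split.
    by rewrite val_eqE nth_uniq ?sl ?ltn_ord // neq_ltn ij.
  apply: (sorted_leq_nth (leT := fun x y : 'I_n => (x <= y)%N)) => //.
  + by move=> x y z; exact: leq_trans.
  + by rewrite inE sl.
  + by rewrite inE sl.
  + exact: ltnW.
- by move=> j; rewrite -lA mem_nth // sl.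
move=> x; rewrite -lA => xl; have ix : (index x l < #|A|)%N by rewrite -sl index_mem.
by exists (Ordinal ix); rewrite /= nth_index.
Qed.

Lemma sorted_index (l : seq nat) (y : nat) : sorted ltn l -> y \in l ->
  index y l = count (fun z => z < y)%N l.
Proof.
elim: l => [//|z l IH] /= pl; rewrite inE eq_sym.
have zl : all (ltn z) l by apply: order_path_min pl; exact: ltn_trans.
case: eqVneq => [<- _|zy /= yl].
  rewrite ltnn add0n; apply/esym/eqP; rewrite -leqn0 leqNgt -has_count.
  by apply/hasPn => w /(allP zl) /= zw; rewrite -leqNgt ltnW.
have /= -> := allP zl _ yl; rewrite add1n IH //; exact: path_sorted pl.
Qed.

Lemma sorted_vertices_sorted F : sorted ltn (sorted_vertices F).
Proof.
rewrite ltn_sorted_uniq_leq sort_uniq map_inj_uniq ?enum_uniq /=; last exact: val_inj.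
by apply: sort_sorted; exact: leq_total.
Qed.

Lemma mem_sorted_vertices F x : (val x \in sorted_vertices F) = (x \in F).
Proof. by rewrite mem_sort mem_map ?mem_enum //; exact: val_inj. Qed.

Lemma size_sorted_vertices F : size (sorted_vertices F) = #|F|.
Proof. by rewrite size_sort size_map cardE. Qed.

(** This translates positions in the sorted lists of [closed_wrt] into counts of smaller
    vertices. *)
Lemma index_sorted_vertices F x : x \in F -> index (val x) (sorted_vertices F) = lowN F x.
Proof.
move=> xF; rewrite sorted_index ?sorted_vertices_sorted ?mem_sorted_vertices //.
rewrite (seq.permP (permEl (perm_sort _ _))) count_map -size_filter /lowN cardE.
apply/perm_size/uniq_perm; rewrite ?enum_uniq ?(filter_uniq _ (enum_uniq _)) // => w.
by rewrite mem_filter !mem_enum [RHS]inE /= andbC.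
Qed.

Lemma nth_sorted_vertices F x : x \in F -> nth 0%N (sorted_vertices F) (lowN F x) = x.
Proof.
by move=> xF; rewrite -index_sorted_vertices // nth_index // mem_sorted_vertices.
Qed.

Lemma sorted_vertices_nth F i : (i < #|F|)%N ->
  exists2 x : 'I_n, x \in F & nth 0%N (sorted_vertices F) i = x /\ lowN F x = i.
Proof.
move=> iF; have : nth 0%N (sorted_vertices F) i \in sorted_vertices F.
  by rewrite mem_nth // size_sorted_vertices.
rewrite mem_sort => /mapP[x]; rewrite mem_enum => xF E; exists x => //; split=> //.
rewrite -index_sorted_vertices // -E index_uniq ?size_sorted_vertices //.
exact/(sorted_uniq ltn_trans ltnn)/sorted_vertices_sorted.
Qed.

Lemma lowN_le A B x : A \subset B -> (lowN A x <= lowN B x)%N.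
Proof.
move=> /subsetP AB; apply/subset_leq_card/subsetP => w; rewrite !inE => /andP[/AB ->].
by [].
Qed.

Lemma highN_le A B x : A \subset B -> (highN A x <= highN B x)%N.
Proof.
move=> /subsetP AB; apply/subset_leq_card/subsetP => w; rewrite !inE => /andP[/AB ->].
by [].
Qed.

(* The position of [x] in a [k.+1]-subset of [A] ranges from [k - highN A x] to [lowN A x]; the
   condition says that the ranges for [A] and [B] do not meet. *)
Definition separated k A B := forall x, x \in A -> x \in B ->
  (lowN A x + highN B x < k)%N \/ (highN A x + lowN B x < k)%N.

(** At a common value in position [i], both [lowN] are at least [i] and both [highN] at least
    [k - i], so neither sum in [separated] could be below [k]. *)
Lemma separated_disjoint k A B : separated k A B -> diag_disjoint k.+1 A B.
Proof.
move=> sep a b ainc binc aA bB i; apply/eqP => ab.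
have := increasing_lowN i ainc aA; have := increasing_highN i ainc aA.
have := increasing_lowN i binc bB; have := increasing_highN i binc bB.
rewrite -ab /=; have := ltn_ord i.
have [] := sep (a i); rewrite ?aA // ?ab ?bB //; lia.
Qed.

Lemma lowN_inj A : {in A &, injective (lowN A)}.
Proof.
have lt x y : x \in A -> (x < y)%N -> (lowN A x < lowN A y)%N.
  move=> xA xy; apply/proper_card/properP; split.
    apply/subsetP => w; rewrite !inE => /andP[-> wx]; exact: ltn_trans xy.
  by exists x; rewrite !inE xA ?xy // ltnn.
move=> x y xA yA E; apply/val_inj; have [/(lt _ _ xA)|/(lt _ _ yA)|//] := ltngtP x y;
by rewrite E ltnn.
Qed.

Lemma highN_inj A : {in A &, injective (highN A)}.
Proof.
move=> x y xA yA E; apply: (@lowN_inj A) => //.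
by have := lowN_highN xA; rewrite E -(lowN_highN yA) => -[/addIn].
Qed.

Lemma card_bounded_inj (f : 'I_n -> nat) A k : {in A &, injective f} ->
  (#|[set x in A | (f x < k)%N]| <= k)%N.
Proof.
move=> finj; rewrite cardE -(size_map f) -[leqRHS](size_iota 0); apply: uniq_leq_size.
  rewrite map_inj_in_uniq ?enum_uniq // => x y; rewrite !mem_enum !inE.
  by move=> /andP[xA _] /andP[yA _]; exact: finj.
by move=> y /mapP[x xk ->]; move: xk; rewrite mem_enum inE mem_iota => /andP[].
Qed.

(** By injectivity of [lowN] and [highN] on [A], at most [k] vertices are near each end. *)
Lemma card_extremes A B k : B \subset A ->
  (forall x, x \in B -> (lowN A x < k)%N \/ (highN A x < k)%N) -> (#|B| <= 2 * k)%N.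
Proof.
move=> /subsetP BA H.
have : B \subset [set x in A | (lowN A x < k)%N] :|: [set x in A | (highN A x < k)%N].
  by apply/subsetP => x xB; rewrite !inE (BA _ xB) /=; apply/orP; exact: H.
move/subset_leq_card/leq_trans; apply; apply: leq_trans (leq_card_setU _ _) _.
rewrite mul2n -addnn leq_add ?card_bounded_inj //; [exact: lowN_inj | exact: highN_inj].
Qed.

Lemma exists_subset_card A k : (k <= #|A|)%N -> exists2 B : {set 'I_n}, B \subset A & #|B| = k.
Proof.
move=> kA; exists [set x in take k (enum A)].
  by apply/subsetP => x; rewrite inE => /mem_take; rewrite mem_enum.
rewrite cardsE (card_uniqP _) ?size_take -?cardE ?take_uniq ?enum_uniq //.
by case: ltngtP kA.
Qed.

Lemma exists_facet_at A x i k : x \in A -> (i <= lowN A x)%N -> (k <= highN A x)%N ->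
  exists F, [/\ F \subset A, x \in F, #|F| = (i + k).+1 & lowN F x = i].
Proof.
move=> xA /exists_subset_card[B1 /subsetP B1s B1c] /exists_subset_card[B2 /subsetP B2s B2c].
have B1A w : w \in B1 -> (w \in A) && (w < x)%N by move/B1s; rewrite inE.
have B2A w : w \in B2 -> (w \in A) && (x < w)%N by move/B2s; rewrite inE.
have low : lowN (x |: (B1 :|: B2)) x = i.
  rewrite /lowN -B1c; apply: eq_card => w; rewrite !inE.
  case B1w: (w \in B1); first by have /andP[_ ->] := B1A _ B1w; rewrite orbT.
  case B2w: (w \in B2).
    by have /andP[_ /ltnW] := B2A _ B2w; rewrite leqNgt => /negPf ->; rewrite andbF.
  by rewrite !orbF; case: eqP => // ->; rewrite ltnn.
have high : highN (x |: (B1 :|: B2)) x = k.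
  rewrite /highN -B2c; apply: eq_card => w; rewrite !inE.
  case B2w: (w \in B2); first by have /andP[_ ->] := B2A _ B2w; rewrite !orbT.
  case B1w: (w \in B1).
    by have /andP[_ /ltnW] := B1A _ B1w; rewrite leqNgt => /negPf ->; rewrite andbF.
  by rewrite !orbF; case: eqP => // ->; rewrite ltnn.
exists (x |: (B1 :|: B2)); split=> //; last by rewrite -(@lowN_highN _ x) ?low ?high // !inE eqxx.
  apply/subsetP => w; rewrite !inE => /or3P[/eqP -> //|/B1A/andP[]//|/B2A/andP[]//].
by rewrite !inE eqxx.
Qed.

(** [b] lists the last [k] vertices of [A]. The bound on [highN] leaves too few vertices above [b i]
    for it to have position [i] in a subset of [k.+1] elements. *)
Lemma top_chain A k : (k <= #|A|)%N -> exists b : 'I_k -> 'I_n,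
  [/\ increasing b, forall j, b j \in A, forall i : 'I_k, (highN A (b i) < k - i)%N
    & forall x, x \in A -> (highN A x < k)%N -> exists j, x = b j].
Proof.
move=> kA; have [a [ainc aA aS]] := increasing_enum A.
have lt (j : 'I_k) : (#|A| - k + j < #|A|)%N by have := ltn_ord j; lia.
have hi (i : 'I_#|A|) : (i + highN A (a i)).+1 = #|A|.
  have := lowN_highN (aA i); have := increasing_lowN i ainc aA.
  by have := increasing_highN i ainc aA; have := ltn_ord i; lia.
exists (fun j => a (Ordinal (lt j))); split=> [i j ij|j|i|x xA hx].
- by apply: ainc; rewrite /= ltn_add2l.
- exact: aA.
- by have := hi (Ordinal (lt i)); have := ltn_ord i; rewrite /=; lia.
have [j xj] := aS x xA; have := hi j; rewrite -xj => hj.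
have jk : (j - (#|A| - k) < k)%N by have := ltn_ord j; lia.
have aux N J h : (J + h).+1 = N -> (h < k)%N -> (N - k <= J)%N by lia.
have kj : (#|A| - k <= j)%N := aux _ _ _ hj hx.
by exists (Ordinal jk); rewrite xj; congr a; apply: val_inj; rewrite /= subnKC.
Qed.
End Positions.

Lemma clique_extension (K : fieldType) m n (s : {perm 'I_n}) (C : {set 'I_n})
    (Cs : seq {set 'I_n}) :
  (2 <= m)%N -> uniq (C :: Cs) ->
  (forall A B, A \in C :: Cs -> B \in C :: Cs -> A != B -> separated m (s @: A) (s @: B)) ->
  (m <= #|C|)%N ->
  (forall D w, D \in Cs -> w \in D -> w \in C ->
     lowN (s @: D) (s w) = 0%N /\ highN (s @: C) (s w) = 0%N) ->
  has_generic_point (igen (cliques_gen K m.+1 Cs)) ->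
  has_generic_point (igen (cliques_gen K m.+1 (C :: Cs))).
Proof.
move=> m2 uCs sep mC top [E [iota [p' p'P]]].
have [|b0 [binc bC bhi bS]] := @top_chain n (s @: C) m.
  by rewrite card_imset //; exact: perm_inj.
pose b j := (s^-1)%g (b0 j).
have sb j : s (b j) = b0 j by rewrite /b permKV.
have bCC j : b j \in C by have := bC j; rewrite -sb mem_imset //; exact: perm_inj.
have CsC D w : D \in Cs -> w \in D -> w \in C -> exists j, w = b j.
  move=> DCs wD wC; have [_ hw] := top D w DCs wD wC.
  have [||j E'] := bS (s w); rewrite ?hw ?imset_f //; first exact: ltnW.
  by exists j; apply: (@perm_inj _ s); rewrite sb.
have reg f : igen (cliques_gen K m.+1 (C :: Cs)) (topminor K m.+1 b * f) ->
    igen (cliques_gen K m.+1 (C :: Cs)) f.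
  apply: (@topminor_regular_perm K m.+1 n s (C :: Cs) m b) => //.
  - by move=> A B AC BC AB; apply: separated_disjoint; exact: sep.
  - by move=> i j ij; rewrite /= !sb; exact: binc.
  move=> D DC a ainc aD i j ij; rewrite sb; apply/eqP => ba.
  have := increasing_highN j ainc aD; have := increasing_lowN j ainc aD.
  rewrite -ba; have := bhi i; have := ltn_ord i.
  move: DC; rewrite inE => /orP[/eqP ->|DCs]; first by rewrite /= -ij; lia.
  have bD : b i \in D by have := aD j; rewrite -ba -sb mem_imset //; exact: perm_inj.
  (* The position [i] would be 0, as the vertex is first in [D], and also [m.-1], as it is last in
     [C]; this contradicts [2 <= m]. *)
  have [] := top D (b i) DCs bD (bCC i); rewrite sb => -> hi0 im _ j0 _.
  have := increasing_highN i binc bC; rewrite hi0; lia.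
exists E, iota; eexists => f.
exact: (generic_extension bCC CsC reg p'P).
Qed.

(** * Labellings of trees of cliques *)

Section Labelling.
Variable n : nat.
Implicit Types (A C D E T : {set 'I_n}) (c L : seq 'I_n) (Cs : seq {set 'I_n}).

(** The list is completed to all vertices, each labelled by its index; the added vertices lie
    outside every [A] considered. *)
Lemma perm_of_list L : uniq L -> exists s : {perm 'I_n}, forall A v,
  {subset A <= L} -> v \in A ->
  lowN (s @: A) (s v) = index v [seq w <- L | w \in A] /\
  highN (s @: A) (s v) = index v (rev [seq w <- L | w \in A]).
Proof.
move=> uL; pose LL := L ++ [seq w <- enum 'I_n | w \notin L].
have uLL : uniq LL.
  rewrite cat_uniq uL filter_uniq ?enum_uniq // andbT.
  by apply/hasPn => w; rewrite mem_filter => /andP[].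
have LLT w : w \in LL by rewrite mem_cat mem_filter mem_enum andbT orbN.
have lt w : (index w LL < n)%N.
  apply: (@leq_trans (size LL)); first by rewrite index_mem.
  by rewrite -(card_uniqP uLL) -[leqRHS]card_ord max_card.
have finj : injective (fun w => Ordinal (lt w)).
  by move=> v w /(congr1 val)/= E; rewrite -(nth_index v (LLT v)) E nth_index.
exists (perm finj) => A v AL vA.
have filA : [seq w <- L | w \in A] = [seq w <- LL | w \in A].
  rewrite filter_cat [X in _ ++ X](_ : _ = [::]) ?cats0 //.
  apply/eqP; rewrite -[_ == _]negbK -has_filter; apply/hasPn => w.
  by rewrite mem_filter => /andP[wL _]; apply: contra wL; exact: AL.
have low : lowN (perm finj @: A) (perm finj v) = index v [seq w <- LL | w \in A].
  have [l1 [l2 E]] : exists l1 l2, LL = l1 ++ v :: l2.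
    exists (take (index v LL) LL), (drop (index v LL).+1 LL).
    by rewrite -[LHS](cat_take_drop (index v LL)) (drop_nth v) ?index_mem // nth_index.
  have [u1 v1] : uniq l1 /\ v \notin l1.
    by move: uLL; rewrite E cat_uniq /= negb_or => /and3P[-> /andP[-> _] _].
  have iv : index v LL = size l1 by rewrite E index_cat (negPf v1) /= eqxx addn0.
  rewrite [in RHS]E filter_cat /= vA index_cat mem_filter (negPf v1) andbF /= eqxx addn0.
  transitivity #|[set w in A | w \in l1]|.
    rewrite /lowN -[RHS](card_imset _ (@perm_inj _ (perm finj))); apply: eq_card => x.
    rewrite -[x](permKV (perm finj)) mem_imset; last exact: perm_inj.
    rewrite !inE mem_imset; last exact: perm_inj.
    move: ((perm finj)^-1%g x) => w; rewrite !permE /= iv; congr (_ && _).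
    rewrite E index_cat; case: ifP => wl1; first by rewrite index_mem.
    by rewrite ltnNge leq_addr.
  rewrite cardE; apply/perm_size/uniq_perm; rewrite ?enum_uniq ?filter_uniq // => w.
  by rewrite mem_enum inE mem_filter.
split; first by rewrite filA.
have sinj := @perm_inj _ (perm finj).
have := lowN_highN (imset_f (perm finj) vA); rewrite card_imset // low filA.
set l := [seq w <- LL | w \in A].
have ul : uniq l by rewrite filter_uniq.
have lA : l =i A by move=> w; rewrite mem_filter LLT andbT.
rewrite -(eq_card lA) (card_uniqP ul).
have : v \in l by rewrite lA.
move=> /splitPr vl; case: vl ul => l1 l2; rewrite cat_uniq /= negb_or.
move=> /and4P[_ /andP[v1 _] v2 _].
rewrite rev_cat rev_cons -cats1 -catA !index_cat mem_rev (negPf v1) (negPf v2) /=.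
by rewrite mem_seq1 eqxx !addn0 size_rev size_cat addnS => -[/addnI].
Qed.

(** An index in [rev c] counts the vertices after [v]. The clause on [v0] serves to make an
    attaching vertex extreme in both of its cliques. *)
Definition fits k T (v0 : 'I_n) c := forall v, v \in T ->
  ((index v c < k)%N \/ (index v (rev c) < k)%N) /\
  (v = v0 -> index v c = 0%N \/ index v (rev c) = 0%N).

Lemma fits_rev k T v0 c : fits k T v0 c -> fits k T v0 (rev c).
Proof.
move=> H v /H; rewrite revK => -[H1 H2]; split; first by case: H1; [right|left].
by case/H2; [right|left].
Qed.

(* The vertex [v0] goes last unless it is [u]. *)
Lemma arrange k C T v0 u : T \subset C -> (#|T| <= 2 * k)%N -> u \in T ->
  exists c, [/\ uniq (u :: c), u :: c =i C & fits k T v0 (u :: c)].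
Proof.
move=> /subsetP TC Tk uT.
pose last0 := if (v0 \in T) && (v0 != u) then [:: v0] else [::].
pose rest := enum (T :\ u :\ v0) ++ last0.
have ur : uniq (u :: rest).
  rewrite /rest /last0 /= mem_cat mem_enum !inE eqxx andbF /= cat_uniq enum_uniq /=.
  case: ifP => /= [/andP[_ v0u]|_]; rewrite ?inE ?(eq_sym u) ?v0u //= ?orbF ?andbT.
  by rewrite mem_enum !inE eqxx.
have mr : u :: rest =i T.
  move=> w; rewrite inE mem_cat mem_enum !inE /last0.
  have [->|wu] := eqVneq w u; first by rewrite uT.
  have [wv|wv0] := eqVneq w v0.
    by rewrite wv in wu *; rewrite wu andbT /=; case: ifP; rewrite ?mem_seq1 ?eqxx.
  by case: ifP; rewrite ?in_nil ?mem_seq1 ?(negPf wv0) orbF.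
(* [T] is cut in two halves of size at most [k], placed at the two ends with [C :\: T] between them.
   Rounding up keeps [u] in the first half. *)
pose h := uphalf (size (u :: rest)).
have sT : size (u :: rest) = #|T| by rewrite -(card_uniqP ur); apply: eq_card.
have h0 : (0 < h)%N by [].
have [t1 t1E] : exists t1, take h (u :: rest) = u :: t1.
  by case: (h) h0 => // h' _; exists (take h' rest).
have tE : u :: rest = u :: t1 ++ drop h (u :: rest).
  by rewrite -cat_cons -t1E cat_take_drop.
set t2 := drop _ _ in tE.
have s1 : (size (u :: t1) <= k)%N.
  rewrite -t1E; apply: leq_trans (_ : h <= _)%N; first by rewrite size_take; case: ltnP.
  rewrite /h sT; lia.
have s2 : (size t2 <= k)%N by rewrite /t2 size_drop /h sT; lia.
exists (t1 ++ enum (C :\: T) ++ t2).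
have memT w : (w \in u :: t1) || (w \in t2) = (w \in T) by rewrite -mem_cat /= -tE mr.
have uc : uniq (u :: t1 ++ enum (C :\: T) ++ t2).
  rewrite -cat_cons (perm_uniq (permEl (perm_catCA _ _ _))) cat_uniq enum_uniq.
  rewrite -[_ ++ t2]/(u :: t1 ++ t2) -tE ur andbT; apply/hasPn => w.
  by rewrite mr mem_enum inE => ->.
split=> //.
  move=> w; rewrite -cat_cons mem_cat mem_cat mem_enum orbCA memT in_setD.
  by have [wT|wT] := boolP (w \in T); rewrite /= ?(TC _ wT) ?orbF.
move=> v vT; split.
  move: vT; rewrite -memT => /orP[vt|vt].
    left; rewrite -cat_cons index_cat vt; apply: leq_trans s1; by rewrite index_mem.
  right; rewrite -cat_cons catA rev_cat index_cat mem_rev vt.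
  by apply: leq_trans s2; rewrite -size_rev index_mem mem_rev.
move=> vv0; subst v; have [->|v0u] := eqVneq v0 u; first by left; rewrite /= eqxx.
right; have [t3 t3E] : exists t3, t2 = rcons t3 v0.
  have restE : u :: rest = rcons (u :: enum (T :\ u :\ v0)) v0.
    by rewrite /rest /last0 vT v0u /= cats1.
  exists (drop h (u :: enum (T :\ u :\ v0))); rewrite /t2 restE drop_rcons //.
  by rewrite /h restE size_rcons /= uphalf_half /=; lia.
by rewrite t3E -cat_cons catA rev_cat rev_rcons /= eqxx.
Qed.

(** The most recently attached clique comes first; it meets the cliques after it in a single vertex
    of a single clique. *)
Fixpoint treelike Cs : Prop :=
  if Cs is C :: Cs' then
    treelike Cs' /\ (Cs' = [::] \/ exists D u,
      [/\ D \in Cs', C :&: D = [set u] & forall A, A \in Cs' -> A != D -> C :&: A = set0])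
  else True.

(** A labelling given by a list of vertices; the last clause is [separated] read off the sublists of
    the cliques. *)
Definition linear_labelling k (T : {set 'I_n} -> {set 'I_n}) v0 Cs L : Prop :=
  [/\ uniq L, forall w, w \in L <-> exists2 C, C \in Cs & w \in C,
      forall C, C \in Cs -> fits k (T C) v0 [seq w <- L | w \in C] &
      forall C D v, C \in Cs -> D \in Cs -> C != D -> v \in C -> v \in D ->
        (index v [seq w <- L | w \in C] + index v (rev [seq w <- L | w \in D]) < k)%N \/
        (index v (rev [seq w <- L | w \in C]) + index v [seq w <- L | w \in D] < k)%N].

(** Inserting the new vertices around [u] leaves the order inside the other cliques intact, since
    these meet [C] at most in [u]. *)
Lemma filter_insert L1 L2 c1 c2 (u : 'I_n) C :
  uniq (L1 ++ u :: L2) -> (forall w, w \in L1 ++ u :: L2 -> w \in C -> w = u) ->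
  uniq (c1 ++ u :: c2) -> c1 ++ u :: c2 =i C ->
  let L' := L1 ++ (c1 ++ u :: c2) ++ L2 in
  [/\ uniq L', [seq w <- L' | w \in C] = c1 ++ u :: c2,
      forall w, (w \in L') = (w \in L1 ++ u :: L2) || (w \in C) &
      forall A : {set 'I_n}, (forall w, w \in A -> w \in C -> w = u) ->
        [seq w <- L' | w \in A] = [seq w <- L1 ++ u :: L2 | w \in A]].
Proof.
move=> uL LC uc cC L'.
have /and3P[uL1 /norP[uL1' _] /andP[uL2' uL2]] :
    [&& uniq L1, ~~ ((u \in L1) || has (mem L1) L2) & (u \notin L2) && uniq L2].
  by move: uL; rewrite cat_uniq.
have L1C w : w \in L1 -> w \notin C.
  move=> wL; apply/negP => wC; have := LC w; rewrite mem_cat wL => /(_ isT wC) wu.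
  by rewrite -wu wL in uL1'.
have L2C w : w \in L2 -> w \notin C.
  move=> wL; apply/negP => wC; have := LC w; rewrite mem_cat inE wL !orbT => /(_ isT wC) wu.
  by rewrite -wu wL in uL2'.
have nil (P : pred 'I_n) s : (forall w, w \in s -> ~~ P w) -> [seq w <- s | P w] = [::].
  by move=> H; apply/eqP; rewrite -[_ == _]negbK -has_filter; apply/hasPn.
split.
- rewrite (perm_uniq (permEl (perm_catCA _ _ _))) cat_uniq uc /=; apply/andP; split.
    apply/hasPn => w; rewrite mem_cat cC => /orP[/L1C|/L2C] //.
  by move: uL; rewrite (perm_uniq (permEl (perm_catCA _ [:: u] _))) /= => /andP[].
- rewrite filter_cat (nil _ L1) // filter_cat (nil _ L2) // cats0.
  by apply/all_filterP/allP => w; rewrite cC.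
- move=> w; rewrite !mem_cat -cC !mem_cat !inE; case: (w \in L1) => //=.
  by case: (w == u); rewrite ?orbT ?orbF //= orbC.
move=> A AC.
have {uc} /and3P[_ /norP[uc1 _] /andP[uc2 _]] :
    [&& uniq c1, ~~ ((u \in c1) || has (mem c1) c2) & (u \notin c2) && uniq c2].
  by move: uc; rewrite cat_uniq.
have c1A w : w \in c1 -> w \notin A.
  by move=> wc; apply: contra uc1 => wA; rewrite -(AC w wA) // -cC mem_cat wc.
have c2A w : w \in c2 -> w \notin A.
  by move=> wc; apply: contra uc2 => wA; rewrite -(AC w wA) // -cC mem_cat inE wc !orbT.
rewrite /L' -catA cat_cons !filter_cat (nil _ c1) //=.
by rewrite filter_cat (nil _ c2).
Qed.

(* The vertices of [C] are inserted next to [u], all before it if [u] is low in [D], all after it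
   otherwise. *)
Lemma labelling_exists k (T : {set 'I_n} -> {set 'I_n}) v0 Cs :
  uniq Cs -> treelike Cs ->
  (forall C, C \in Cs -> T C \subset C /\ (#|T C| <= 2 * k)%N) ->
  (forall C D v, C \in Cs -> D \in Cs -> C != D -> v \in C -> v \in D -> v \in T C) ->
  exists L, linear_labelling k T v0 Cs L.
Proof.
elim: Cs => [|C Cs IH] /=.
  by move=> _ _ _ _; exists [::]; split=> // w; split=> // -[].
move=> /andP[CCs uCs] [tCs att] TC TS.
have [tC Tk] := TC C (mem_head _ _).
have [||L [uL mL fL sL]] := IH uCs tCs.
- by move=> D DCs; apply: TC; rewrite inE DCs orbT.
- by move=> D A v DCs ACs; apply: TS; rewrite inE ?DCs ?ACs orbT.
case: att => [E|[D [u [DCs CDu CA]]]].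
  subst Cs; have {mL L uL fL sL} : True by [].
  have [u|T0] := pickP [pred u in T C].
    rewrite /= => uT; have [c [uc cC fc]] := arrange v0 tC Tk uT.
    have fil : [seq w <- u :: c | w \in C] = u :: c.
      by apply/all_filterP/allP => w; rewrite cC.
    exists (u :: c); split=> //.
    + move=> w; rewrite cC; split=> [wC|[A]]; last by rewrite inE => /eqP ->.
      by exists C; rewrite ?mem_head.
    + by move=> A; rewrite inE => /eqP ->; rewrite fil.
    + by move=> A B v; rewrite !inE => /eqP -> /eqP ->; rewrite eqxx.
  exists (enum C); split; first exact: enum_uniq.
  + move=> w; rewrite mem_enum; split=> [wC|[A]]; last by rewrite inE => /eqP ->.
    by exists C; rewrite ?mem_head.
  + by move=> A; rewrite inE => /eqP -> v vT; have := T0 v; rewrite /= vT.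
  + by move=> A B v; rewrite !inE => /eqP -> /eqP ->; rewrite eqxx.
have CD : C != D by apply: contraNneq CCs => ->.
have /setIP[uC uD] : u \in C :&: D by rewrite CDu set11.
have CAu A w : A \in Cs -> w \in A -> w \in C -> w = u /\ A = D.
  move=> ACs wA wC; have [AD|AD] := eqVneq A D.
    by split=> //; apply/set1P; rewrite -CDu inE wC -AD.
  by have := CA A ACs AD => /setP/(_ w); rewrite !inE wA wC.
have uTC : u \in T C by apply: (TS C D) => //; rewrite inE ?eqxx ?DCs ?orbT.
have uTD : u \in T D by apply: (TS D C) => //; rewrite ?inE ?eqxx ?DCs ?orbT // eq_sym.
have [c [uc cC fc]] := arrange v0 tC Tk uTC.
have uL' : u \in L by apply/mL; exists D.
have [L1 [L2 LE]] : exists L1 L2, L = L1 ++ u :: L2.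
  exists (take (index u L) L), (drop (index u L).+1 L).
  by rewrite -[LHS](cat_take_drop (index u L)) (drop_nth u) ?index_mem // nth_index.
have LC w : w \in L -> w \in C -> w = u by move=> /mL[A ACs wA] /(CAu A w ACs wA)[].
have fu : index u (u :: c) = 0%N by rewrite /= eqxx.
suff [c1 [c2 [uc12 cC12 fc12 sep]]] : exists c1 c2, [/\ uniq (c1 ++ u :: c2), c1 ++ u :: c2 =i C,
    fits k (T C) v0 (c1 ++ u :: c2) &
    (index u (c1 ++ u :: c2) + index u (rev [seq w <- L | w \in D]) < k)%N \/
    (index u (rev (c1 ++ u :: c2)) + index u [seq w <- L | w \in D] < k)%N].
  rewrite LE in uL LC mL fL sL sep.
  have [uL'' fC mL' fA] := filter_insert uL LC uc12 cC12.
  set L' := (L1 ++ _) in uL'' fC mL' fA.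
  have {}fA A : A \in Cs -> [seq w <- L' | w \in A] = [seq w <- L1 ++ u :: L2 | w \in A].
    by move=> ACs; apply: fA => w wA wC; have [] := CAu A w ACs wA wC.
  exists L'; split=> //.
  - move=> w; rewrite mL'; split=> [/orP[/mL[A ACs wA]|wC]|[A]].
    + by exists A; rewrite // inE ACs orbT.
    + by exists C; rewrite ?mem_head.
    rewrite inE => /orP[/eqP -> ->|ACs wA]; first by rewrite orbT.
    by apply/orP; left; apply/mL; exists A.
  - move=> A; rewrite inE => /orP[/eqP ->|ACs]; first by rewrite fC.
    by rewrite fA //; exact: fL.
  move=> A B v; rewrite !inE => /orP[/eqP ->|ACs] /orP[/eqP ->|BCs] AB vA vB.
  - by rewrite eqxx in AB.
  - by have [-> ->] := CAu B v BCs vB vA; rewrite fC fA.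
  - have [-> ->] := CAu A v ACs vA vB; rewrite fC fA //.
    by case: sep; rewrite addnC; [right|left].
  - by rewrite !fA //; exact: sL.
have [[lo|hi] _] := fL D DCs u uTD.
  exists (rev c), [::]; have E : rev c ++ [:: u] = rev (u :: c) by rewrite rev_cons cats1.
  rewrite E; split; [by rewrite rev_uniq | by move=> w; rewrite mem_rev cC | exact: fits_rev |].
  by right; rewrite revK fu.
by exists [::], c; split=> //; left; rewrite fu.
Qed.
End Labelling.

Section Reverse.
Variable n : nat.
Implicit Types (A B : {set 'I_n}) (s : {perm 'I_n}).

Definition rev_perm : {perm 'I_n} := perm (@rev_ord_inj n).

Lemma rev_perm_ltn (x y : 'I_n) : (rev_perm x < rev_perm y)%N = (y < x)%N.
Proof. by rewrite !permE /=; have := ltn_ord x; have := ltn_ord y; lia. Qed.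

Lemma lowN_rev s A v : lowN ((s * rev_perm)%g @: A) ((s * rev_perm)%g v) = highN (s @: A) (s v).
Proof.
rewrite /lowN /highN -[RHS](card_imset _ (@perm_inj _ rev_perm)); apply: eq_card => x.
rewrite -[x](permKV rev_perm) mem_imset; last exact: perm_inj.
rewrite !inE permM rev_perm_ltn; congr (_ && _).
rewrite (eq_imset _ (permM s rev_perm)) imset_comp mem_imset //; exact: perm_inj.
Qed.

Lemma highN_rev s A v : highN ((s * rev_perm)%g @: A) ((s * rev_perm)%g v) = lowN (s @: A) (s v).
Proof.
have E : s = (s * rev_perm * rev_perm)%g.
  by apply/permP => x; rewrite !permM !permE rev_ordK.
by rewrite [in RHS]E lowN_rev.
Qed.
End Reverse.

Lemma linear_labelling_perm n k (T : {set 'I_n} -> {set 'I_n}) v0 Cs L :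
  linear_labelling k T v0 Cs L -> exists s : {perm 'I_n},
    (forall A v, A \in Cs -> v \in A ->
      lowN (s @: A) (s v) = index v [seq w <- L | w \in A] /\
      highN (s @: A) (s v) = index v (rev [seq w <- L | w \in A])) /\
    (forall A B, A \in Cs -> B \in Cs -> A != B -> separated k (s @: A) (s @: B)).
Proof.
move=> [uL mL _ sL]; have [s sP] := perm_of_list uL.
have pos A v : A \in Cs -> v \in A ->
    lowN (s @: A) (s v) = index v [seq w <- L | w \in A] /\
    highN (s @: A) (s v) = index v (rev [seq w <- L | w \in A]).
  by move=> ACs; apply: sP => w wA; apply/mL; exists A.
exists s; split=> // A B ACs BCs AB _ /imsetP[v vA ->]; rewrite mem_imset; last exact: perm_inj.
move=> vB; have [-> ->] := pos A v ACs vA; have [-> ->] := pos B v BCs vB.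
exact: sL.
Qed.

Lemma treelike_generic_point (K : fieldType) m n (T : {set 'I_n} -> {set 'I_n}) Cs :
  (2 <= m)%N -> uniq Cs -> treelike Cs ->
  (forall C, C \in Cs -> [/\ T C \subset C, (#|T C| <= 2 * m)%N & (m < #|C|)%N]) ->
  (forall C D v, C \in Cs -> D \in Cs -> C != D -> v \in C -> v \in D -> v \in T C) ->
  has_generic_point (igen (cliques_gen K m.+1 Cs)).
Proof.
move=> m2; elim: Cs => [|C Cs IH] uCs tCs TC TS.
  have [E [iota [p H]]] := generic_point K (m.+1 * n).
  exists E, iota, p => f; split=> [/cliques_gen_nil ->|/H ->]; first exact: rmorph0.
  exact: igen0.
have Cs_gen : has_generic_point (igen (cliques_gen K m.+1 Cs)).
  have [[_ u] [t _]] := (andP uCs, tCs).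
  apply: IH => // [D DCs|D A v DCs ACs].
    by apply: TC; rewrite inE DCs orbT.
  by apply: TS; rewrite inE ?DCs ?ACs orbT.
have [_ _ mC] := TC C (mem_head _ _).
have [_ [E|[D [u [DCs CDu CA]]]]] := tCs.
  apply: (@clique_extension K m n 1%g) => //; last by rewrite E.
    by move=> A B; rewrite E !inE => /eqP -> /eqP ->; rewrite eqxx.
  exact: ltnW.
have DCCs : D \in C :: Cs by rewrite inE DCs orbT.
(* The labelling is built anew with the attaching vertex [u] as [v0], which puts [u] at an end of
   both [C] and [D]. *)
have [|L LL] := @labelling_exists n m T u (C :: Cs) uCs tCs _ TS.
  by move=> A /TC[].
have [s [pos sep]] := linear_labelling_perm LL.
case: LL => uL mL fL sL.
have /setIP[uC uD] : u \in C :&: D by rewrite CDu set11.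
have CD : C != D by apply: contraTneq uCs => ->; rewrite /= DCs.
have CAu A w : A \in Cs -> w \in A -> w \in C -> w = u /\ A = D.
  move=> ACs wA wC; have [AD|AD] := eqVneq A D.
    by split=> //; apply/set1P; rewrite -CDu inE wC -AD.
  by have := CA A ACs AD => /setP/(_ w); rewrite !inE wA wC.
have [lC hC] := pos C u (mem_head _ _) uC; have [lD hD] := pos D u DCCs uD.
have uTC : u \in T C by apply: (TS C D) => //; exact: mem_head.
have uTD : u \in T D by apply: (TS D C) => //; [exact: mem_head | rewrite eq_sym].
have [_ /(_ erefl)] := fL C (mem_head _ _) u uTC.
have [_ /(_ erefl)] := fL D DCCs u uTD.
rewrite -lC -hC -lD -hD => eD eC.
have cC := lowN_highN (imset_f s uC); have cD := lowN_highN (imset_f s uD).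
rewrite !card_imset in cC cD; try exact: perm_inj.
have [_ _ mD] := TC D DCCs.
(* [u] is extreme in both cliques; [separated] excludes the same extreme. *)
have [[l0 h0]|[h0 l0]] : (lowN (s @: D) (s u) = 0 /\ highN (s @: C) (s u) = 0)%N \/
    (highN (s @: D) (s u) = 0 /\ lowN (s @: C) (s u) = 0)%N.
  have := sep C D (mem_head _ _) DCCs CD (s u) (imset_f s uC) (imset_f s uD).
  lia.
- apply: (@clique_extension K m n s) => //; first exact: ltnW.
  by move=> A w ACs wA wC; have [-> ->] := CAu A w ACs wA wC.
(* Reversing the labelling exchanges first and last. *)
apply: (@clique_extension K m n (s * rev_perm n)%g) => //; last 2 first.
- exact: ltnW.
- by move=> A w ACs wA wC; have [-> ->] := CAu A w ACs wA wC; rewrite lowN_rev highN_rev.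
move=> A B ACs BCs AB _ /imsetP[v vA ->]; rewrite mem_imset; last exact: perm_inj.
move=> vB; rewrite !lowN_rev !highN_rev.
by have [] := sep A B ACs BCs AB (s v) (imset_f s vA) (imset_f s vB); [right|left].
Qed.

(** * Attaching the cliques along the tree *)

Lemma path_exit (T : eqType) (e : rel T) (P : pred T) x p :
  path e x p -> P x -> ~~ P (last x p) -> exists y z, [/\ P y, ~~ P z & e y z].
Proof.
elim: p x => [|z p IH] x /=; first by move=> _ ->.
move=> /andP[exz pz] Px Pl; have [Pz|Pz] := boolP (P z); first exact: IH pz Pz Pl.
by exists x, z.
Qed.

Section TreeOrder.
Variables (m n : nat) (Fs : {set {set 'I_n}}).
Hypothesis ci : cond_i m Fs.
Hypothesis tree : G_Delta_tree m Fs.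
Notation adj := (gadj m Fs).

Lemma gadj_sym C D : adj C D = adj D C.
Proof. by rewrite /gadj eq_sym setIC andbCA. Qed.

(** Connectedness yields a new clique adjacent to the list, acyclicity makes its neighbour in the
    list unique. Paths inside the list are carried through the induction in order to close
    cycles. *)
Lemma tree_sublist k : (k <= #|cliques m Fs|)%N -> exists Cs : seq {set 'I_n},
  [/\ uniq Cs, {subset Cs <= cliques m Fs}, size Cs = k, treelike Cs &
      forall A B, A \in Cs -> B \in Cs ->
        exists p, [/\ path adj A p, last A p = B & {subset p <= Cs}]].
Proof.
elim: k => [_|k IH kc]; first by exists [::].
have [Cs [uCs sCs szCs tCs cCs]] := IH (ltnW kc).
have [B0 B0c B0Cs] : exists2 B, B \in cliques m Fs & B \notin Cs.
  apply/exists_inP; apply: contraLR kc; rewrite negb_exists -leqNgt => /forallP H.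
  rewrite -szCs cardE; apply: uniq_leq_size; first exact: enum_uniq.
  by move=> B; rewrite mem_enum => Bc; have := H B; rewrite Bc negbK.
have [E|[A0 A0Cs]] : Cs = [::] \/ exists A, A \in Cs.
  by case: (Cs) => [|A s]; [left | right; exists A; rewrite mem_head].
  exists [:: B0]; rewrite -szCs E; split=> //.
  - by move=> B; rewrite inE => /eqP ->.
  - by split=> //; left.
  - by move=> A B; rewrite !inE => /eqP -> /eqP ->; exists [::].
have [conn acyc] := tree.
have [p [pp lp]] := conn A0 B0 (sCs _ A0Cs) B0c.
have [||D [C [DCs CCs DC]]] := @path_exit _ adj (mem Cs) A0 p pp => //; first by rewrite lp.
have /and4P[Dc Cc nDC ne] := DC; rewrite /= in DCs CCs.
have CD : adj C D by rewrite gadj_sym.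
have uniqD A : A \in Cs -> A != D -> C :&: A = set0.
  move=> ACs AD; apply/eqP; apply: contraT => CA0.
  have AC : adj A C.
    rewrite gadj_sym /gadj Cc (sCs A ACs) CA0 andbT /=.
    by apply: contraNneq CCs => ->.
  (* A second neighbour [A] would give a cycle: from [C] to [D], along a simple path in the list to
     [A], and back to [C]. *)
  have [q [pq lq sq]] := cCs D A DCs ACs.
  have : last D q = A by [].
  case/shortenP: pq => q' pq' uq' sq' lq'.
  have szq : (3 <= size (C :: D :: q'))%N.
    by case: q' lq' {pq' uq' sq'} => [|//] /= DA; rewrite DA eqxx in AD.
  have uq : uniq (C :: D :: q').
    rewrite cons_uniq uq' andbT inE negb_or; apply/andP; split.
      by apply: contraNneq CCs => ->.
    by apply: contra CCs => /sq'/sq.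
  have /negP[] := acyc _ szq uq.
  by rewrite /= rcons_path CD pq' lq' AC.
exists (C :: Cs); split.
- by rewrite /= CCs.
- by move=> A; rewrite inE => /orP[/eqP -> //|/sCs].
- by rewrite /= szCs.
- split=> //; right; have := ci Cc Dc; rewrite eq_sym => /(_ nDC).
  have CD0 : C :&: D != set0 by rewrite setIC.
  rewrite leq_eqVlt ltnS leqn0 cards_eq0 (negPf CD0) orbF => /cards1P[u E].
  by exists D, u.
move=> A B; rewrite !inE => /orP[/eqP ->|ACs] /orP[/eqP ->|BCs].
- by exists [::].
- have [q [pq lq sq]] := cCs D B DCs BCs; exists (D :: q); rewrite /= CD; split=> //.
  by move=> X; rewrite !inE => /orP[/eqP ->|/sq ->]; rewrite ?DCs orbT.
- have [q [pq lq sq]] := cCs A D ACs DCs; exists (rcons q C).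
  rewrite rcons_path pq lq DC last_rcons; split=> //.
  by move=> X; rewrite mem_rcons !inE => /orP[->//|/sq ->]; rewrite orbT.
have [q [pq lq sq]] := cCs A B ACs BCs; exists q; split=> // X /sq XCs.
by rewrite inE XCs orbT.
Qed.

Lemma treelike_cliques : exists Cs, [/\ uniq Cs, Cs =i cliques m Fs & treelike Cs].
Proof.
have [Cs [uCs sCs szCs tCs _]] := tree_sublist (leqnn _).
exists Cs; split=> // A; rewrite -[RHS]mem_enum.
have [||_ ->] := @uniq_min_size _ Cs (enum (cliques m Fs)) uCs => //.
  by move=> B /sCs; rewrite mem_enum.
by rewrite szCs -cardE.
Qed.
End TreeOrder.

Lemma subset_imset_perm n (s : {perm 'I_n}) (A F : {set 'I_n}) : F \subset s @: A ->
  exists2 G : {set 'I_n}, G \subset A & F = s @: G.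
Proof.
move=> /subsetP FA; exists (s^-1%g @: F).
  apply/subsetP => _ /imsetP[x xF ->]; have /imsetP[y yA ->] := FA x xF.
  by rewrite permK.
by rewrite -imset_comp -[LHS]imset_id; apply: eq_imset => x /=; rewrite permKV.
Qed.

(** * Closed labellings and the degree bound *)

Section Cliques.
Variables (m n : nat) (Fs : {set {set 'I_n}}).
Hypothesis m_ge2 : (2 <= m)%N.
Hypothesis pure : pure_dim m.+1 Fs.
Hypothesis ci : cond_i m.+1 Fs.
Hypothesis cii : cond_ii m.+1 Fs.
Notation cl := (cliques m.+1 Fs).
Implicit Types (C D E F G : {set 'I_n}).

Lemma clique_facet C F : C \in cl -> F \subset C -> #|F| = m.+1 -> F \in Fs.
Proof.
rewrite inE => /maxsetp/andP[_ /forallP H] FC Fm.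
by have := H F; rewrite FC Fm eqxx.
Qed.

Lemma clique_card C : C \in cl -> (m < #|C|)%N.
Proof. by rewrite inE => /maxsetp/andP[]. Qed.

Lemma in_S_clique G : in_S m.+1 Fs G -> exists2 C, C \in cl & G \subset C.
Proof. by move=> /maxset_exists[C mC GC]; exists C; rewrite // inE. Qed.

Lemma facet_clique F : F \in Fs -> exists2 C, C \in cl & F \subset C.
Proof.
move=> FFs; have Fm := pure.2 F FFs; apply: in_S_clique; rewrite /in_S Fm leqnn.
apply/forallP => G; apply/implyP => /andP[GF /eqP Gm].
by have /eqP -> : G == F by rewrite eqEcard GF Fm Gm leqnn.
Qed.

Lemma clique_unique C D F : C \in cl -> D \in cl -> F \subset C -> F \subset D ->
  #|F| = m.+1 -> C = D.
Proof.
move=> Cc Dc FC FD Fm; apply/eqP; apply: contraT => /(ci Cc Dc).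
have : (#|F| <= #|C :&: D|)%N by rewrite subset_leq_card // subsetI FC.
by rewrite Fm; lia.
Qed.

Definition shared C := [set v in C | [exists D in cl, (D != C) && (v \in D)]].

Lemma mem_shared C D v : D \in cl -> C != D -> v \in C -> v \in D -> v \in shared C.
Proof.
move=> Dc CD vC vD; rewrite inE vC; apply/exists_inP; exists D => //.
by rewrite eq_sym CD.
Qed.

Lemma shared_sub C : shared C \subset C.
Proof. by apply/subsetP => v; rewrite inE => /andP[]. Qed.

(** Sending a shared vertex to another clique through it is a bijection onto the neighbours:
    injective by condition (i), surjective by condition (ii). *)
Lemma deg_shared C : C \in cl -> deg_G m.+1 Fs C = #|shared C|.
Proof.
move=> Cc; pose nb v := odflt set0 [pick D in cl | (D != C) && (v \in D)].
have nbP v : v \in shared C -> [/\ nb v \in cl, nb v != C & v \in nb v].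
  rewrite inE /nb => /andP[_ /exists_inP[D Dc Dv]].
  by case: pickP => [A /and3P[]|/(_ D)] //; rewrite Dc Dv.
rewrite /deg_G -(card_in_imset (f := nb) (D := shared C)); last first.
  move=> v w vs ws E; have [Dc DC vD] := nbP v vs; have [_ _ wD] := nbP w ws.
  apply/eqP; apply: contraT => vw; have := ci Dc Cc DC.
  have : (#|[set v; w]| <= #|nb v :&: C|)%N.
    apply/subset_leq_card/subsetP => x; rewrite !inE => /orP[/eqP ->|/eqP ->].
      by rewrite vD (subsetP (shared_sub C)).
    by rewrite E wD (subsetP (shared_sub C)).
  by rewrite cards2 vw; lia.
apply: eq_card => D; rewrite inE; apply/idP/imsetP.
  move=> /and4P[_ Dc CD /set0Pn[v /setIP[vC vD]]].
  have vs := mem_shared Dc CD vC vD; exists v => //.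
  have [Ac AC vA] := nbP v vs; apply/eqP; apply: contraT => DA.
  have := cii Cc Dc Ac CD _ DA; rewrite eq_sym => /(_ AC)/setP/(_ v).
  by rewrite !inE vC vD vA.
move=> [v vs ->]; have [Dc DC vD] := nbP v vs; rewrite /gadj Cc Dc eq_sym DC /=.
by apply/set0Pn; exists v; rewrite inE vD (subsetP (shared_sub C)).
Qed.

(** With [m] vertices of [C] on either side, [v] could take any position in a facet of [C], in
    particular one it has in a facet of [D]. Closedness would then put both facets into one clique,
    equal to [C] and to [D]. *)
Lemma closed_extreme (s : {perm 'I_n}) C D v :
  closed_wrt m.+1 [set s @: (F : {set 'I_n}) | F in Fs] -> C \in cl -> D \in cl -> C != D ->
  v \in C -> v \in D -> (lowN (s @: C) (s v) < m)%N \/ (highN (s @: C) (s v) < m)%N.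
Proof.
move=> clo Cc Dc CD vC vD.
have [?|lo] := ltnP (lowN (s @: C) (s v)) m; first by left.
have [?|hi] := ltnP (highN (s @: C) (s v)) m; first by right.
have sinj := @perm_inj _ s.
(* A position that the vertex does take in some facet inside [D]: at least [m] vertices of [D] lie
   on its two sides together. *)
pose i := minn m (lowN (s @: D) (s v)).
have im : (i <= m)%N by rewrite geq_minl.
have k1 : (m - i <= highN (s @: D) (s v))%N.
  have := lowN_highN (imset_f s vD); rewrite card_imset //.
  by have := clique_card Dc; rewrite /i; lia.
have [G [GD vG Gm Gi]] := exists_facet_at (imset_f s vD) (geq_minr _ _ : (i <= _)%N) k1.
have [F [FC vF Fm Fi]] := exists_facet_at (imset_f s vC) (leq_trans im lo)
  (leq_trans (leq_subr i m) hi).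
have [F0 F0C FE] := subset_imset_perm FC; have [G0 G0D GE] := subset_imset_perm GD.
rewrite subnKC // in Fm Gm.
have F0m : #|F0| = m.+1 by rewrite -Fm FE card_imset.
have G0m : #|G0| = m.+1 by rewrite -Gm GE card_imset.
have F0s := clique_facet Cc F0C F0m; have G0s := clique_facet Dc G0D G0m.
have [|A Ac FGA] := @in_S_clique (F0 :|: G0).
  rewrite /in_S -F0m subset_leq_card ?subsetUl //=; apply/forallP => H0.
  apply/implyP => /andP[HFG /eqP H0m].
  have : s @: H0 \in [set s @: (F : {set 'I_n}) | F in Fs].
    apply: (clo F G); rewrite ?FE ?GE ?imset_f //.
    - by exists i; rewrite ?ltnS // -FE -GE -{1}Fi -Gi !nth_sorted_vertices.
    - by rewrite -imsetU imsetS.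
    - by rewrite card_imset // H0m.
  by rewrite mem_imset //; exact: imset_inj.
have CA : C = A by apply: clique_unique F0m => //; apply: subset_trans FGA; rewrite subsetUl.
have DA : D = A by apply: clique_unique G0m => //; apply: subset_trans FGA; rewrite subsetUr.
by rewrite CA DA eqxx in CD.
Qed.

Lemma closed_card_shared C : is_closed m.+1 Fs -> C \in cl -> (#|shared C| <= 2 * m)%N.
Proof.
move=> [s clo] Cc; rewrite -(card_imset _ (@perm_inj _ s)).
apply: (@card_extremes _ (s @: C)); first by rewrite imsetS // shared_sub.
move=> _ /imsetP[v + ->]; rewrite inE => /andP[vC /exists_inP[D Dc /andP[DC vD]]].
by apply: (closed_extreme clo Cc Dc); rewrite // eq_sym.
Qed.

(** If facets of different cliques agree in position [i], their common vertex has at least [i]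
    vertices below and [m - i] above in both cliques, against [separated]. *)
Lemma separated_closed (s : {perm 'I_n}) :
  (forall C D, C \in cl -> D \in cl -> C != D -> separated m (s @: C) (s @: D)) ->
  closed_wrt m.+1 [set s @: (F : {set 'I_n}) | F in Fs].
Proof.
move=> sep _ _ /imsetP[F FFs ->] /imsetP[G GFs ->] [i im E] H HFG Hm.
have sinj := @perm_inj _ s.
have [C Cc FC] := facet_clique FFs; have [D Dc GD] := facet_clique GFs.
have Fm : #|s @: F| = m.+1 by rewrite card_imset // (pure.2 F FFs).
have Gm : #|s @: G| = m.+1 by rewrite card_imset // (pure.2 G GFs).
have [CD|CD] := eqVneq C D.
  have [|H0 H0C HE] := @subset_imset_perm n s C H.
    by apply: subset_trans HFG _; rewrite subUset !imsetS // CD.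
  rewrite HE imset_f //; apply: (clique_facet Cc H0C).
  by rewrite -Hm HE card_imset.
have [|x xF [xi xl]] := @sorted_vertices_nth n (s @: F) i; first by rewrite Fm.
have [|y yG [yi yl]] := @sorted_vertices_nth n (s @: G) i; first by rewrite Gm.
have xy : x = y by apply: val_inj; rewrite /= -xi -yi.
subst y.
have sFC := imsetS s FC; have sGD := imsetS s GD.
have := sep C D Cc Dc CD x (subsetP sFC x xF); move=> /(_ (subsetP sGD x yG)).
have := lowN_le x sFC; have := highN_le x sFC.
have := lowN_le x sGD; have := highN_le x sGD.
have := lowN_highN xF; have := lowN_highN yG.
rewrite Fm Gm xl yl => -[h1] [h2] h3 h4 h5 h6 h7; exfalso.
case: h7; [rewrite -h1 | rewrite -h2 addnC]; by rewrite ltnNge leq_add.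
Qed.
End Cliques.

(** * The facet ideal as the ideal of all minors of the cliques *)

Section FacetIdeal.
Variables (K : fieldType) (m n : nat) (Fs : {set {set 'I_n}}).
Hypothesis m_ge2 : (2 <= m)%N.
Hypothesis pure : pure_dim m.+1 Fs.
Notation J := (@J_Delta K m.+1 n Fs).
Notation cl := (cliques m.+1 Fs).

Lemma J_Delta_ideal : ideal J.
Proof.
split.
- by exists (fun=> 0); rewrite big1 // => F _; rewrite mul0r.
- move=> _ _ [c ->] [d ->]; exists (fun F => c F + d F).
  by rewrite -big_split; apply: eq_bigr => F _; rewrite mulrDl.
move=> r _ [c ->]; exists (fun F => r * c F).
by rewrite mulr_sumr; apply: eq_bigr => F _; rewrite mulrA.
Qed.

Lemma J_Delta_minor F : F \in Fs -> J (minor K m.+1 F).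
Proof.
move=> FFs; exists (fun G => (G == F)%:R); rewrite (bigD1 F) //= eqxx mul1r.
by rewrite big1 ?addr0 // => G /andP[_ /negPf ->]; rewrite mul0r.
Qed.

Lemma minor_topminor (F : {set 'I_n}) : #|F| = m.+1 -> exists b : 'I_m.+1 -> 'I_n,
  [/\ forall j, b j \in F, forall j, lowN F (b j) = j & minor K m.+1 F = topminor K m.+1 b].
Proof.
move=> Fm; have /fin_all_exists[b bP] (j : 'I_m.+1) : exists x : 'I_n,
    [/\ x \in F, nth 0%N (sorted_vertices F) j = x & lowN F x = j].
  have [|x xF [H1 H2]] := @sorted_vertices_nth n F j; first by rewrite Fm.
  by exists x.
exists b; split=> [j|j|]; try by case: (bP j).
congr (\det _); apply/matrixP => i j; rewrite !mxE /xvar.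
by have [_ -> _] := bP j.
Qed.

(** A repeated column gives 0; otherwise the columns form a facet, and sorting them costs the sign
    of a permutation. *)
Lemma J_Delta_topminor (C : {set 'I_n}) (a : 'I_m.+1 -> 'I_n) : C \in cl -> (forall j, a j \in C) ->
  J (topminor K m.+1 a).
Proof.
move=> Cc aC; have [J0 _ JM] := J_Delta_ideal.
have [/injectiveP ainj|] := boolP (injectiveb a); last first.
  move=> /injectivePn[i [j ij aij]]; rewrite (_ : topminor _ _ _ = 0) //.
  rewrite /topminor -det_tr; apply: (determinant_alternate ij) => l.
  by rewrite !mxE aij.
pose F := [set a j | j : 'I_m.+1].
have Fm : #|F| = m.+1 by rewrite card_imset // card_ord.
have FFs : F \in Fs.
  apply: (clique_facet Cc) => //; by apply/subsetP => _ /imsetP[j _ ->].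
have [b [bF blow bE]] := minor_topminor Fm.
have aF j : a j \in F by apply: imset_f.
have lt j : (lowN F (a j) < m.+1)%N.
  by rewrite -Fm -(lowN_highN (aF j)) ltnS leq_addr.
pose sig j := Ordinal (lt j).
have bs j : b (sig j) = a j by apply: (@lowN_inj n F) => //; rewrite blow.
have siginj : injective sig by move=> i j E; apply: ainj; rewrite -!bs E.
have -> : topminor K m.+1 a = (-1) ^+ (perm siginj)^-1%g * minor K m.+1 F.
  rewrite bE /topminor -[in RHS]det_perm mulrC -det_mulmx.
  rewrite -col_permE; congr (\det _).
  by apply/matrixP => i j; rewrite !mxE permE bs.
by apply: JM; exact: J_Delta_minor.
Qed.

Lemma J_Delta_cliques Cs : Cs =i cl -> forall f, J f <-> igen (cliques_gen K m.+1 Cs) f.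
Proof.
move=> CsE f; split.
  move=> [c ->]; have [I0 ID IM] := igen_ideal (cliques_gen K m.+1 Cs).
  elim/big_ind: _ => // F FFs; apply: IM.
  have [b [bF _ ->]] := minor_topminor (pure.2 F FFs).
  have [C Cc FC] := facet_clique pure FFs.
  apply: igen_sub; exists C; first by rewrite CsE.
  by exists b => // j; apply: (subsetP FC).
apply: igen_min; first exact: J_Delta_ideal.
by move=> _ [C CCs [a aC ->]]; apply: J_Delta_topminor aC; rewrite -CsE.
Qed.
End FacetIdeal.

Lemma generic_point_prime (K : fieldType) m n (I J : mpoly K (m * n) -> Prop) :
  has_generic_point I -> (forall f, J f <-> I f) -> prime_ideal J.
Proof.
move=> [E [iota [p H]]] IJ; have {IJ}H f : J f <-> mev iota p (m * n) f = 0.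
  by rewrite -H; exact: IJ.
split; [|split; [|split; [|split]]].
- by move=> a b /H Ja /H Jb; apply/H; rewrite rmorphD Ja Jb addr0.
- by move=> a b /H Jb; apply/H; rewrite rmorphM Jb mulr0.
- by apply/H; rewrite rmorph0.
- by move=> /H/eqP; rewrite rmorph1 oner_eq0.
move=> a b /H/eqP; rewrite rmorphM mulf_eq0 => /orP[]/eqP ?; [left | right]; exact/H.
Qed.

Close Scope ring_scope.
Theorem theorem3p2 (K : fieldType) (m n : nat) (Fs : {set {set 'I_n}}) :
  (2 <= m.-1)%N ->
  pure_dim m Fs ->
  cond_i m Fs -> cond_ii m Fs ->
  G_Delta_tree m Fs ->
  (is_closed m Fs -> prime_ideal (@J_Delta K m n Fs)) /\
  (is_closed m Fs <->
     forall C, C \in cliques m Fs -> (deg_G m Fs C <= minn #|C| (2 * m.-1))%N).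
Proof.
(* From here on [m] is the dimension of the complex, and facets have [m.+1] vertices. *)
case: m => [//|m] m2 pure ci cii tree; rewrite /= in m2 *.
have [Cs [uCs CsE tCs]] := treelike_cliques ci tree.
(* Closedness and the degree bound both give the bound on shared vertices from which labellings are
   built. *)
have sharedP : is_closed m.+1 Fs \/ (forall C, C \in cliques m.+1 Fs ->
    (deg_G m.+1 Fs C <= minn #|C| (2 * m))%N) ->
    forall C, C \in Cs ->
    [/\ shared m Fs C \subset C, (#|shared m Fs C| <= 2 * m)%N & (m < #|C|)%N].
  move=> H C; rewrite CsE => Cc; split; [exact: shared_sub | | exact: clique_card Cc].
  case: H => [clo|/(_ C Cc)]; first exact: (closed_card_shared _ ci).
  by rewrite (deg_shared _ ci cii) // leq_min => /andP[].
have memP C D v : C \in Cs -> D \in Cs -> C != D -> v \in C -> v \in D -> v \in shared m Fs C.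
  by move=> _ DCs; apply: mem_shared; rewrite -CsE.
split.
  move=> clo; have gp := @treelike_generic_point K m n (shared m Fs) Cs m2 uCs tCs
    (sharedP (or_introl clo)) memP.
  by apply: (@generic_point_prime K m.+1 n _ _ gp) => f; apply: J_Delta_cliques.
split=> [clo C Cc|deg].
  rewrite (deg_shared _ ci cii) // leq_min subset_leq_card ?shared_sub //.
  exact: (closed_card_shared _ ci).
have [F FFs] := set0Pn _ pure.1.
have [v0 _] : exists v0 : 'I_n, v0 \in F.
  by apply/set0Pn; rewrite -card_gt0 (pure.2 F FFs).
have [|L LL] := @labelling_exists n m (shared m Fs) v0 Cs uCs tCs _ memP.
  by move=> C /(sharedP (or_intror deg))[].
have [s [_ sep]] := linear_labelling_perm LL.
exists s; apply: separated_closed => // C D; rewrite -!CsE; exact: sep.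
Qed.
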